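(* Let $r$ be a positive integer or $\infty$ and $n\ge0$. Each of the following is a basis of $\mathrm{QSym}^r_n(x)$, where $(\beta,\mu)$ ranges over $r$-compositions of $n$: (1) $\{M_{(\beta,\mu)}\}$; (2) $\{S_{(\beta,\mu)}\}$; (3) $\{\overline{F}_{(\beta,\mu)}\}$; (4) $\{\overline{S}_{(\beta,\mu)}\}$.
   Context: An $r$-composition of $n$ is a pair $(\beta,\mu)$ with $\beta=(\beta_1,\dots,\beta_k)$ a composition all of whose parts are $\ge r$, $\mu=(\mu_1,\dots,\mu_l)$ a partition all of whose parts are $<r$, and $|\beta|+|\mu|=n$. $M_{(\beta,\mu)}=\sum x_{i_1}^{\beta_1}\cdots x_{i_k}^{\beta_k}x_{i_{k+1}}^{\mu_1}\cdots x_{i_{k+l}}^{\mu_l}$ over distinct positive integers $i_1,\dots,i_{k+l}$ with $i_1<\dots<i_k$ (commuting variables); $\mathrm{QSym}^r_n(x)$ is the $\mathbb{Q}$-span of the $M_{(\beta,\mu)}$ with $(\beta,\mu)$ an $r$-composition of $n$. An edge-coloured digraph is a finite simple digraph with each edge dashed ($\dashrightarrow$), solid ($\rightarrow$) or double ($\Rightarrow$); a proper vertex-colouring is $\kappa:V\to\mathbb{P}$ with $\kappa(a)\ne\kappa(b)$, $\kappa(a)<\kappa(b)$, $\kappa(a)\le\kappa(b)$ for dashed, solid, double edges $(a,b)$ respectively; $\mathscr{X}_G(x)=\sum_\kappa\prod_{a}x_{\kappa(a)}$ over proper vertex-colourings. The dashed (resp. solid, double) sum of $G_1,G_2$ is their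 disjoint union plus a dashed (resp. solid, double) edge $(a,b)$ for all $a\in V(G_1)$, $b\in V(G_2)$. $C_m$ is the directed cycle on $m$ vertices with all edges double (a single vertex if $m=1$). For a partition $\mu=(\mu_1,\dots,\mu_l)$, $G_\mu$ has vertex set $\{(i,j):1\le i\le l,1\le j\le\mu_i\}$, solid edges $(i,j)\rightarrow(i+1,j)$ and double edges $(i,j)\Rightarrow(i,j+1)$ (so $\mathscr{X}_{G_\mu}$ is the Schur function $s_\mu$). Let $A_\beta$ be the solid sum $C_{\beta_1}$ solid-sum $\cdots$ solid-sum $C_{\beta_k}$, $B_\beta$ the double sum $C_{\beta_1}$ double-sum $\cdots$ double-sum $C_{\beta_k}$, and $D_\mu$ the dashed sum $C_{\mu_1}$ dashed-sum $\cdots$ dashed-sum $C_{\mu_l}$. Then $M_{(\beta,\mu)}=\mathscr{X}_{A_\beta\,\text{dashed-sum}\,D_\mu}$, and define $S_{(\beta,\mu)}=\mathscr{X}_{A_\beta\,\text{dashed-sum}\,G_\mu}$, $\overline{F}_{(\beta,\mu)}=\mathscr{X}_{B_\beta\,\text{dashed-sum}\,D_\mu}$, $\overline{S}_{(\beta,\mu)}=\mathscr{X}_{B_\beta\,\text{dashed-sum}\,G_\mu}$. *)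

(* Defs.v *)
From HB Require Import structures.
From mathcomp Require Import all_boot all_algebra.
Set Implicit Arguments. Unset Strict Implicit. Unset Printing Implicit Defensive.
Import GRing.Theory.

(** r is a positive integer ([Some k], k > 0) or infinity ([None]). *)
Definition ge_r (r : option nat) (b : nat) : bool :=
  if r is Some k then k <= b else false.
Definition lt_r (r : option nat) (m : nat) : bool :=
  if r is Some k then m < k else true.

Definition rcomp (r : option nat) (n : nat) (bm : seq nat * seq nat) : bool :=
  let: (beta, mu) := bm in
  [&& all (fun b => (0 < b) && ge_r r b) beta,
      all (fun m => (0 < m) && lt_r r m) mu,
      sorted geq mu &
      sumn beta + sumn mu == n].

Inductive ekind := Dashed | Solid | Double.

Definition ek_ok (k : ekind) (x y : nat) : bool :=
  match k with Dashed => x != y | Solid => x < y | Double => x <= y end.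

Record egraph := EGraph { vert : finType ; edge : vert -> vert -> option ekind }.
Arguments edge : clear implicits.

Definition proper (G : egraph) (kap : vert G -> nat) : bool :=
  [forall a, forall b,
     if edge G a b is Some k then ek_ok k (kap a) (kap b) else true].
Arguments proper : clear implicits.

(** A formal power series in x_1, x_2, ... with rational coefficients is
    represented by its coefficient function: [F alpha] is the coefficient of
    x_1^{alpha_1} ... x_m^{alpha_m}, where alpha = [:: alpha_1; ...; alpha_m]. *)
Definition series := seq nat -> rat.

(** coefficient of x^alpha in X_G: number of proper colourings kappa : V -> P
    with #kappa^{-1}(i) = alpha_i for all i >= 1 (colour 0 is forced unused). *)
Definition coefXG (G : egraph) (alpha : seq nat) : nat :=
  #|[pred kap : {ffun vert G -> 'I_(size alpha).+1} |
      proper G (fun a => val (kap a)) &&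
      [forall i : 'I_(size alpha).+1,
         #|[pred a | kap a == i]| == nth 0 (0 :: alpha) i]]|.

Definition chromX (G : egraph) : series := fun alpha => ((coefXG G alpha)%:R)%R.

Definition egraph0 : egraph := @EGraph void (fun _ _ => None).

Definition gsum (k : ekind) (G1 G2 : egraph) : egraph :=
  @EGraph (vert G1 + vert G2)%type
    (fun a b => match a, b with
                | inl x, inl y => edge G1 x y
                | inr x, inr y => edge G2 x y
                | inl _, inr _ => Some k
                | inr _, inl _ => None
                end).

Definition cyc (m : nat) : egraph :=
  @EGraph 'I_m (fun i j =>
    if (1 < m) && (val j == (val i).+1 %% m) then Some Double else None).

Definition cycsum (k : ekind) (s : seq nat) : egraph :=
  foldr (fun m G => gsum k (cyc m) G) egraph0 s.

Definition A_ (beta : seq nat) := cycsum Solid beta.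
Definition B_ (beta : seq nat) := cycsum Double beta.
Definition D_ (mu : seq nat) := cycsum Dashed mu.

Definition Gvert (mu : seq nat) :=
  {p : 'I_(size mu) * 'I_(sumn mu) | val p.2 < nth 0 mu p.1}.

Definition G_ (mu : seq nat) : egraph :=
  @EGraph (Gvert mu : finType) (fun p q =>
    let: (i, j) := (val (val p).1, val (val p).2) in
    let: (i', j') := (val (val q).1, val (val q).2) in
    if (i' == i.+1) && (j' == j) then Some Solid
    else if (i' == i) && (j' == j.+1) then Some Double
    else None).

Definition Mf (bm : seq nat * seq nat) : series :=
  chromX (gsum Dashed (A_ bm.1) (D_ bm.2)).
Definition Sf (bm : seq nat * seq nat) : series :=
  chromX (gsum Dashed (A_ bm.1) (G_ bm.2)).
Definition Fbarf (bm : seq nat * seq nat) : series :=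
  chromX (gsum Dashed (B_ bm.1) (D_ bm.2)).
Definition Sbarf (bm : seq nat * seq nat) : series :=
  chromX (gsum Dashed (B_ bm.1) (G_ bm.2)).

Definition lincomb (s : seq (seq nat * seq nat)) (c : seq nat * seq nat -> rat)
    (f : seq nat * seq nat -> series) : series :=
  fun alpha => (\sum_(a <- s) c a * f a alpha)%R.

Definition inQSym (r : option nat) (n : nat) (F : series) : Prop :=
  exists s c, all (rcomp r n) s /\ forall alpha, F alpha = lincomb s c Mf alpha.

Definition is_basis_QSym (r : option nat) (n : nat)
    (f : seq nat * seq nat -> series) : Prop :=
  [/\ (forall a, rcomp r n a -> inQSym r n (f a)),
      (forall F, inQSym r n F ->
         exists s c, all (rcomp r n) s /\ forall alpha, F alpha = lincomb s c f alpha) &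
      (forall s c, uniq s -> all (rcomp r n) s ->
         (forall alpha, lincomb s c f alpha = 0%R) ->
         forall a, a \in s -> c a = 0%R)].

(* Main.v *)
Require Import Defs.
From mathcomp Require Import all_boot all_algebra.
From mathcomp Require Import zify.
Set Implicit Arguments. Unset Strict Implicit. Unset Printing Implicit Defensive.
Import GRing.Theory Num.Theory.

(** Colourings are counted one colour at a time: the vertices of the smallest
    colour form a layer, and removing it leaves the same problem with one colour
    fewer.  For a dashed sum this splits every word of positive exponents into
    a subword for each summand.  In all four families the first summand only
    produces exponents [>= r] and the second only exponents [< r], so the
    splitting is forced, and the coefficient of [F_(b,m)] at [s] is the product of
    the coefficient of the first graph at the subword of large letters and of
    the second one at the subword of small letters.  The latter is symmetric
    in its letters; hence the series is determined by its coefficients at the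
    words [b ++ m] with [(b, m)] an [r]-composition, and the matrix of these
    coefficients is triangular: a nonzero coefficient of [B_b] forces a
    coarsening of [b], and a semistandard tableau of shape [m] has entries at
    least their row index. *)

(** * Layers of a colouring *)

Section LayerCount.

Variable G : egraph.
Implicit Types (W U : {set vert G}) (s : seq nat).

(* Condition on an edge ending in the layer [U] and starting at a vertex that is not
   coloured yet; [inU] tells whether that vertex is in [U] too. Edges leaving [U]
   for a later layer are always admissible. *)
Definition layer_edge (k : ekind) (inU : bool) : bool :=
  match k with Dashed => ~~ inU | Solid => false | Double => inU end.

Definition layer W U :=
  (U \subset W) && [forall x in W, forall y in U,
    if edge G x y is Some k then layer_edge k (x \in U) else true].

Fixpoint lcount W s : nat :=
  if s is a :: s' then
    \sum_(U : {set vert G} | layer W U && (#|U| == a)) lcount (W :\: U) s'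
  else W == set0.

(** Colour 0 marks the vertices outside [W], so colourings of any subset are functions on the whole
    vertex set. *)
Definition colouring_on W s (kap : {ffun vert G -> 'I_(size s).+1}) :=
  [&& [forall x, (x \in W) == (kap x != ord0)],
      [forall x in W, forall y in W,
         if edge G x y is Some k then ek_ok k (kap x) (kap y) else true] &
      [forall i : 'I_(size s), #|[pred x | kap x == lift ord0 i]| == nth 0 s i]].

Definition add_layer m U (kap : {ffun vert G -> 'I_m.+1}) : {ffun vert G -> 'I_m.+2} :=
  [ffun x => if x \in U then lift ord0 ord0
             else if kap x == ord0 then ord0 else lift ord0 (kap x)].

(** Colours 0 and 1 both become 0: the removed layer joins the vertices outside the set. *)
Definition drop_layer m (kap : {ffun vert G -> 'I_m.+2}) : {ffun vert G -> 'I_m.+1} :=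
  [ffun x => inord (kap x).-1].

Lemma val_drop_layer m (kap : {ffun vert G -> 'I_m.+2}) x :
  drop_layer kap x = (kap x).-1 :> nat.
Proof. by rewrite ffunE inordK //; case: (kap x) => -[|i] /= . Qed.

Lemma val_add_layer U m (kap : {ffun vert G -> 'I_m.+1}) x :
  add_layer U kap x = (if x \in U then 1 else if kap x == 0 :> nat then 0 else (kap x).+1) :> nat.
Proof. by rewrite ffunE; case: ifP => // _; rewrite -val_eqE /=; case: ifP. Qed.

(** Removing the class of colour 1 and shifting the other colours down is a bijection onto the
    colourings of what remains. *)
Lemma card_colouring_on W s : #|[pred kap | @colouring_on W s kap]| = lcount W s.
Proof.
elim: s W => [|a s IH] W /=.
  pose k0 : {ffun vert G -> 'I_1} := [ffun => ord0].
  have k0E (k : {ffun vert G -> 'I_1}) : k = k0.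
    by apply/ffunP=> x; rewrite ffunE; apply/val_inj; case: (k x) => -[].
  rewrite -sum1_card; have [W0|W0] := eqVneq W set0.
    rewrite (eq_bigl (pred1 k0)) ?big_pred1_eq // => k; rewrite !inE (k0E k) eqxx.
    apply/and3P; split.
    - by apply/forallP=> x; rewrite W0 inE ffunE.
    - by apply/forall_inP=> x; rewrite W0 inE.
    - by apply/forallP=> -[].
  rewrite big1 // => k; rewrite inE => /and3P[/forallP h _ _].
  have [x xW] := set0Pn _ W0; move: (h x); rewrite xW.
  by rewrite (k0E k) ffunE.
rewrite -sum1_card.
(* The colourings are grouped by their class of colour 1, which is [lift ord0 ord0]; properness on
   the edges into this class is the layer condition. *)
pose p (k : {ffun vert G -> 'I_(size s).+2}) : {set vert G} := [set x | k x == lift ord0 ord0].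
rewrite (partition_big p (fun U => layer W U && (#|U| == a))) /=; last first.
  move=> k; rewrite inE => /and3P[/forallP h1 /forall_inP h2 /forallP h3].
  apply/andP; split; last first.
    have /eqP h30 := h3 ord0; rewrite -[X in _ == X]h30 /p cardsE; apply/eqP/eq_card => x; by rewrite !inE.
  apply/andP; split.
    by apply/subsetP=> x; rewrite inE => /eqP kx; rewrite (eqP (h1 x)) kx.
  apply/forall_inP=> x xW; apply/forall_inP=> y; rewrite inE => /eqP ky.
  have yW : y \in W by rewrite (eqP (h1 y)) ky.
  have := forall_inP (h2 x xW) y yW; move: (h1 x); rewrite xW eq_sym eqb_id.
  rewrite ky inE -!val_eqE /=.
  by case: (edge G x y) => // -[] /=; case: (k x) => -[|[|i]].
apply: eq_bigr => U /andP[/andP[/subsetP sUW /forall_inP hU] cU].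
rewrite -IH -sum1_card (reindex_onto (@add_layer (size s) U) (@drop_layer _)) /=; last first.
  move=> k /andP[/and3P[/forallP h1 _ _] /eqP pk].
  apply/ffunP=> x; apply/val_inj; rewrite /= val_add_layer val_drop_layer -pk inE -!val_eqE /=.
  by case: (k x) => -[|[|i]].
apply: eq_bigl => k; rewrite !inE.
(* The side condition left by the reindexing: dropping a layer undoes adding it exactly for the
   colourings that leave [U] uncoloured. *)
have -> : drop_layer (add_layer U k) == k = [forall x in U, k x == ord0].
  apply/eqP/forall_inP => [h x xU|h].
    by rewrite -h -val_eqE /= val_drop_layer val_add_layer xU.
  apply/ffunP=> x; apply/val_inj; rewrite /= val_drop_layer val_add_layer.
  case: ifP => [/h/eqP->//|_]; by case: (k x) => -[].
apply/idP/idP.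
  move=> /andP[/andP[/and3P[/forallP h1 /forall_inP h2 /forallP h3] /eqP pk] /forall_inP hk].
  apply/and3P; split.
  - apply/forallP=> x; move: (h1 x); rewrite !inE -!val_eqE /= val_add_layer.
    case: ifP => [xU _|xU]; first by rewrite (eqP (hk x xU)).
    by case: (k x) => -[].
  - apply/forall_inP=> x; rewrite inE => /andP[xU xW]; apply/forall_inP=> y; rewrite inE => /andP[yU yW].
    move: (forall_inP (h2 x xW) y yW) (h1 x) (h1 y); rewrite xW yW -!val_eqE /= !val_add_layer (negPf xU) (negPf yU).
    by case: (edge G x y) => // e; case: (k x) => -[|i] //= _; case: (k y) => -[|j] //= _; case: e.
  - apply/forallP=> i; have := h3 (lift ord0 i); rewrite /= => /eqP <-; apply/eqP/eq_card => x.
    rewrite !inE -!val_eqE /= val_add_layer; case: ifP => [/hk/eqP->//|_].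
    by case: (k x) => -[].
move=> /and3P[/forallP h1 /forall_inP h2 /forallP h3].
have hk x : x \in U -> k x = ord0.
  by move=> xU; move: (h1 x); rewrite inE xU /= eq_sym eqbF_neg negbK => /eqP.
apply/andP; split; last by apply/forall_inP=> x /hk ->.
have pE : p (add_layer U k) = U.
  apply/setP=> x; rewrite inE -val_eqE /= val_add_layer; case: ifP => // _.
  by case: (k x) => -[].
rewrite pE eqxx andbT; apply/and3P; split.
- apply/forallP=> x; move: (h1 x); rewrite inE -!val_eqE /= val_add_layer.
  case: ifP => [xU _|xU]; first by rewrite (sUW _ xU).
  by case: (k x) => -[].
- apply/forall_inP=> x xW; apply/forall_inP=> y yW; rewrite !val_add_layer.
  have kz z : z \in W -> z \notin U -> k z != ord0.
    by move=> zW zU; move: (h1 z); rewrite inE zW zU /= => /eqP <-.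
  case xU: (x \in U); case yU: (y \in U).
  + by have := forall_inP (hU x xW) y yU; case: (edge G x y) => // -[]; rewrite xU.
  + have := kz y yW (negbT yU); rewrite -val_eqE /=; case: (edge G x y) => // -[]; by case: (k y) => -[].
  + have := forall_inP (hU x xW) y yU; have := kz x xW (negbT xU); rewrite -val_eqE /=.
    by rewrite xU; case: (edge G x y) => // -[]; case: (k x) => -[].
  + have xWU : x \in W :\: U by rewrite inE xU.
    have yWU : y \in W :\: U by rewrite inE yU.
    have := forall_inP (h2 x xWU) y yWU.
    have := kz x xW (negbT xU); have := kz y yW (negbT yU); rewrite -!val_eqE /=.
    case: (edge G x y) => // e; case: (k x) => -[|i] //= _; case: (k y) => -[|j] //= _; by case: e.
- apply/forallP=> i; case: (unliftP ord0 i) => [j|] -> /=.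
    rewrite -(eqP (h3 j)); apply/eqP/eq_card => x; rewrite !inE -!val_eqE /= val_add_layer.
    case: ifP => [/hk->//|_]; by case: (k x) => -[].
  by rewrite -(eqP cU) -{2}pE /p cardsE; apply/eqP/eq_card => x; rewrite !inE.
Qed.

Lemma coefXG_lcount s : coefXG G s = lcount setT s.
Proof.
rewrite -card_colouring_on; apply: eq_card => k; rewrite !inE /proper.
apply/idP/idP.
  move=> /andP[/forallP h1 /forallP h2]; apply/and3P; split.
  - apply/forallP=> x; rewrite inE /= eq_sym eqb_id; apply/negP => kx.
    have := h2 ord0; rewrite /= => /eqP/card0_eq/(_ x); by rewrite !inE kx.
  - by apply/forall_inP=> x _; apply/forall_inP=> y _; apply: (forallP (h1 x)).
  - by apply/forallP=> i; have := h2 (lift ord0 i).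
move=> /and3P[/forallP h1 /forall_inP h2 /forallP h3]; apply/andP; split.
  by apply/forallP=> x; apply/forallP=> y; apply: (forall_inP (h2 x _)); rewrite inE.
apply/forallP=> i; case: (unliftP ord0 i) => [j|] ->; first exact: h3.
by rewrite /=; apply/eqP/eq_card0=> x; rewrite !inE; move: (h1 x); rewrite inE eq_sym eqb_id => /negPf.
Qed.

Lemma layer0 W : layer W set0.
Proof.
rewrite /layer sub0set /=; apply/forall_inP=> x _; apply/forall_inP=> y; by rewrite inE.
Qed.

Lemma lcount_cons0 W s : lcount W (0 :: s) = lcount W s.
Proof.
rewrite /= (eq_bigl (pred1 set0)) ?big_pred1_eq ?setD0 // => U /=.
rewrite cards_eq0; have [->|//] := eqVneq U set0; [by rewrite layer0|by rewrite andbF].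
Qed.

(** A layer of size 0 is empty and removes nothing. This is quasisymmetry: only the word of positive
    exponents matters. *)
Lemma lcount_filter W s : lcount W s = lcount W (filter (leq 1) s).
Proof.
elim: s W => // -[|a] s IH W; first by rewrite lcount_cons0 IH.
by rewrite /=; apply: eq_bigr => U _; rewrite IH.
Qed.

Lemma lcount_set0 s : all (leq 1) s -> lcount set0 s = (s == [::]).
Proof.
case: s => [|[|a] s] //= _; first by rewrite eqxx.
by apply: big1 => U /andP[/andP[]]; rewrite subset0 => /eqP ->; rewrite cards0.
Qed.

Lemma lcount_sumn W s : 0 < lcount W s -> sumn s = #|W|.
Proof.
elim: s W => [|a s IH] W /=; first by case: eqP => // ->; rewrite cards0.
rewrite lt0n sum_nat_eq0 negb_forall => /existsP[U]; rewrite negb_imply -lt0n.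
case/andP => /andP[/andP[sUW _] /eqP <-] /IH ->.
by rewrite cardsD (setIidPr sUW) subnKC // subset_leq_card.
Qed.

End LayerCount.

(** * Shuffles and sums of graphs *)

(** The total of [f t1 * g t2] over all splittings of the word into complementary subwords [t1] and
    [t2]; letters already handed out are stored in the function arguments. *)
Fixpoint shuffle (f g : seq nat -> nat) (s : seq nat) : nat :=
  if s is a :: s' then
    shuffle (fun t => f (a :: t)) g s' + shuffle f (fun t => g (a :: t)) s'
  else f [::] * g [::].

Lemma eq_shuffle f f' g g' s :
  all (leq 1) s ->
  (forall t, all (leq 1) t -> f t = f' t) -> (forall t, all (leq 1) t -> g t = g' t) ->
  shuffle f g s = shuffle f' g' s.
Proof.
elim: s f f' g g' => [|a s IH] f f' g g' /= hs hf hg; first by rewrite hf ?hg.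
have [a0 hs'] := andP hs.
by congr (_ + _); apply: IH => // t ht; rewrite ?hf ?hg //= a0.
Qed.

Lemma shuffle_suml (I : finType) (P : pred I) (F : I -> seq nat -> nat) g s :
  shuffle (fun t => \sum_(i | P i) F i t) g s = \sum_(i | P i) shuffle (F i) g s.
Proof.
elim: s F g => [|a s IH] F g /=; first by rewrite big_distrl.
by rewrite (IH (fun i t => F i (a :: t))) IH big_split.
Qed.

Lemma shuffle_sumr (I : finType) (P : pred I) f (F : I -> seq nat -> nat) s :
  shuffle f (fun t => \sum_(i | P i) F i t) s = \sum_(i | P i) shuffle f (F i) s.
Proof.
elim: s F f => [|a s IH] F f /=; first by rewrite big_distrr.
by rewrite (IH (fun i t => F i (a :: t))) IH big_split.
Qed.

Lemma shuffle0l f g s : (forall t, f t = 0) -> shuffle f g s = 0.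
Proof. by elim: s f g => [|a s IH] f g h /=; rewrite ?h ?IH. Qed.

Lemma shuffle0r f g s : (forall t, g t = 0) -> shuffle f g s = 0.
Proof. by elim: s f g => [|a s IH] f g h /=; rewrite ?h ?muln0 ?IH. Qed.

Lemma shuffle_nill f g s : (forall a t, f (a :: t) = 0) -> shuffle f g s = f [::] * g s.
Proof.
by move=> h; elim: s g => [|a s IH] g //=; rewrite shuffle0l // IH.
Qed.

(** Each letter can go to one side only, as decided by [p], so a single splitting survives. *)
Lemma shuffle_filter (p : pred nat) f g s : all (leq 1) s ->
  (forall t, all (leq 1) t -> 0 < f t -> all p t) ->
  (forall t, all (leq 1) t -> 0 < g t -> all (predC p) t) ->
  shuffle f g s = f (filter p s) * g (filter (predC p) s).
Proof.
elim: s f g => [|a s IH] f g //= /andP[a0 hs] hf hg.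
have hfa t : all (leq 1) t -> 0 < f (a :: t) -> p a && all p t.
  by move=> ht /hf /=; rewrite a0; apply.
have hga t : all (leq 1) t -> 0 < g (a :: t) -> ~~ p a && all (predC p) t.
  by move=> ht /hg /=; rewrite a0; apply.
case pa: (p a) => /=.
  rewrite (IH (fun t => f (a :: t)) g) //; last by move=> t /hfa h /h /andP[].
  rewrite (@eq_shuffle f f _ (fun=> 0) s) // ?shuffle0r ?addn0 //.
  by move=> t ht; case: (posnP (g (a :: t))) => // /(hga _ ht); rewrite pa.
rewrite (IH f (fun t => g (a :: t))) //; last by move=> t /hga h /h /andP[].
rewrite (@eq_shuffle (fun t => f (a :: t)) (fun=> 0) g g s) // ?shuffle0l //.
by move=> t ht; case: (posnP (f (a :: t))) => // /(hfa _ ht); rewrite pa.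
Qed.

Definition perm_inv (f : seq nat -> nat) :=
  forall s t, all (leq 1) s -> perm_eq s t -> f s = f t.

(** Adjacent transpositions generate all permutations. *)
Lemma perm_inv_swap f :
  (forall p a b s, all (leq 1) (p ++ a :: b :: s) -> f (p ++ a :: b :: s) = f (p ++ b :: a :: s)) ->
  perm_inv f.
Proof.
(* A common prefix [p] is carried along, so that [h] applies while the first letter of [s] travels
   to its place in [t]. *)
move=> h; suff H n s t p : size s = n -> all (leq 1) (p ++ s) -> perm_eq s t -> f (p ++ s) = f (p ++ t).
  by move=> s t; apply: (H _ s t [::]).
elim: n s t p => [|n IH] s t p.
  by move=> /size0nil-> _; rewrite perm_sym => /perm_nilP->.
case: s => // a s [ss] hp st.
have at_ : a \in t by rewrite -(perm_mem st) mem_head.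
have {at_} [t1 [t2 et]] : exists t1 t2, t = t1 ++ a :: t2.
  by case/splitPr: at_ => t1 t2; exists t1, t2.
have st' : perm_eq s (t1 ++ t2).
  by rewrite -(perm_cons a) (perm_trans st) // et (perm_catCA t1 [:: a] t2).
rewrite -cat_rcons (IH s (t1 ++ t2)) ?cat_rcons // et.
have: all (leq 1) (p ++ a :: t1 ++ t2).
  move: hp; rewrite !all_cat /= (perm_all _ st') all_cat => /andP[-> /andP[-> ->]] //.
elim: t1 p {hp et st' IH st} => // b t1 IH1 p hp /=.
rewrite h //.
have hp' : all (leq 1) (rcons p b ++ a :: t1 ++ t2).
  by move: hp; rewrite -cats1 !all_cat /= !all_cat; do !case: (all _ _) => //=; lia.
by have := IH1 _ hp'; rewrite !cat_rcons.
Qed.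

Lemma perm_inv_cons f a : perm_inv f -> 0 < a -> perm_inv (fun t => f (a :: t)).
Proof. by move=> h a0 s t hs st; apply: h; rewrite /= ?a0 // perm_cons. Qed.

(** Two adjacent letters that go to the same side are exchanged by the symmetry of that side; the
    two splittings that separate them trade places. *)
Lemma perm_inv_shuffle f g : perm_inv f -> perm_inv g -> perm_inv (shuffle f g).
Proof.
move=> hf hg; apply: perm_inv_swap => p a b s.
elim: p f g hf hg => [|c p IH] f g hf hg /=; last first.
  by move=> /andP[c0 hs]; rewrite !IH //; apply: perm_inv_cons.
move=> /and3P[a0 b0 hs]; rewrite -!addnA [X in _ = _ + X]addnCA; congr (_ + (_ + (_ + _))).
- by apply: eq_shuffle => // t ht; apply: hf => /=; rewrite ?a0 ?b0 // (perm_catCA [:: a] [:: b] t).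
- by apply: eq_shuffle => // t ht; apply: hg => /=; rewrite ?a0 ?b0 // (perm_catCA [:: a] [:: b] t).
Qed.

Lemma shuffle_gt0 f g s : all (leq 1) s -> 0 < shuffle f g s ->
  exists t1 t2, [/\ all (leq 1) t1, all (leq 1) t2, perm_eq s (t1 ++ t2), 0 < f t1 & 0 < g t2].
Proof.
elim: s f g => [|a s IH] f g /=.
  by rewrite muln_gt0 => _ /andP[h1 h2]; exists [::], [::].
move=> /andP[a0 hs]; rewrite addn_gt0 => /orP[] /(IH _ _ hs)[t1 [t2 [h1 h2 st f1 g2]]].
  by exists (a :: t1), t2; split; rewrite //= ?a0 // perm_cons.
exists t1, (a :: t2); split; rewrite //= ?a0 //.
by rewrite perm_sym (perm_catCA t1 [:: a] t2) perm_sym perm_cons.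
Qed.

Section DisjointSum.

Variables (V1 V2 : finType).

Definition dsum (W1 : {set V1}) (W2 : {set V2}) : {set (V1 + V2)%type} :=
  [set x | match x with inl y => y \in W1 | inr y => y \in W2 end].

Lemma dsumE W1 W2 x :
  (x \in dsum W1 W2) = match x with inl y => y \in W1 | inr y => y \in W2 end.
Proof. by rewrite inE. Qed.

Lemma dsumD W1 W2 U1 U2 : dsum W1 W2 :\: dsum U1 U2 = dsum (W1 :\: U1) (W2 :\: U2).
Proof. by apply/setP=> -[] x; rewrite !(inE, dsumE). Qed.

Lemma dsumT : dsum setT setT = setT.
Proof. by apply/setP=> -[] x; rewrite !(inE, dsumE). Qed.

Lemma card_dsum W1 W2 : #|dsum W1 W2| = #|W1| + #|W2|.
Proof.
have -> : dsum W1 W2 = [set inl x | x in W1] :|: [set inr y | y in W2].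
  apply/setP=> -[] x; rewrite !inE; apply/idP/orP.
  - by move=> h; left; apply: imset_f.
  - by case=> /imsetP[y h []] // ->.
  - by move=> h; right; apply: imset_f.
  - by case=> /imsetP[y h []] // ->.
rewrite cardsU disjoint_setI0 ?cards0 ?subn0.
  by rewrite !card_imset //; [move=> x y [] | move=> x y []].
by rewrite -setI_eq0; apply/eqP/setP=> z; rewrite !inE; apply/negP=> /andP[/imsetP[x _ ->] /imsetP[y _]].
Qed.

Lemma dsum_eq0 W1 W2 : (dsum W1 W2 == set0) = (W1 == set0) && (W2 == set0).
Proof. by rewrite -!cards_eq0 card_dsum addn_eq0. Qed.

Lemma dsum_sub W1 W2 U1 U2 :
  (dsum U1 U2 \subset dsum W1 W2) = (U1 \subset W1) && (U2 \subset W2).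
Proof. by rewrite -!setD_eq0 dsumD dsum_eq0. Qed.

Lemma big_dsum (P : pred {set (V1 + V2)%type}) (F : {set (V1 + V2)%type} -> nat) :
  \sum_(U | P U) F U = \sum_U1 \sum_(U2 | P (dsum U1 U2)) F (dsum U1 U2).
Proof.
pose h (p : {set V1} * {set V2}) := dsum p.1 p.2.
pose h' (U : {set (V1 + V2)%type}) := ([set x | inl x \in U], [set y | inr y \in U]).
rewrite (reindex_onto h h') /=; last first.
  by move=> U _; apply/setP=> -[] x; rewrite !inE.
rewrite pair_big_dep /=; apply: eq_bigl => -[U1 U2] /=.
rewrite (_ : h' _ = (U1, U2)) ?eqxx ?andbT //.
by congr (_, _); apply/setP=> x; rewrite !inE.
Qed.

End DisjointSum.

Section GraphSum.

Variables G1 G2 : egraph.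
Implicit Types (s : seq nat).

Definition cross_layer (k : ekind) (W1 U1 : {set vert G1}) (U2 : {set vert G2}) :=
  [forall x in W1, forall y in U2, layer_edge k (x \in U1)].

Lemma layer_gsum k W1 W2 U1 U2 :
  @layer (gsum k G1 G2) (dsum W1 W2) (dsum U1 U2) =
  [&& layer W1 U1, layer W2 U2 & cross_layer k W1 U1 U2].
Proof.
rewrite /layer dsum_sub -!andbA; case: (U1 \subset W1) => //=; rewrite [RHS]andbCA; congr (_ && _).
apply/forall_inP/and3P => [h|[/forall_inP h1 /forall_inP h2 /forall_inP h3]].
  split.
  - apply/forall_inP=> x xW; apply/forall_inP=> y yU.
    by have := forall_inP (h (inl x) _) (inl y); rewrite !dsumE; apply.
  - apply/forall_inP=> x xW; apply/forall_inP=> y yU.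
    by have := forall_inP (h (inr x) _) (inr y); rewrite !dsumE; apply.
  - apply/forall_inP=> x xW; apply/forall_inP=> y yU.
    by have := forall_inP (h (inl x) _) (inr y); rewrite !dsumE; apply.
move=> [] x; rewrite dsumE => xW; apply/forall_inP=> -[] y; rewrite !dsumE => yU //=.
- exact: (forall_inP (h1 x xW)).
- by have /forall_inP/(_ y yU) := h3 x xW.
- exact: (forall_inP (h2 x xW)).
Qed.

Lemma cross_layer0 k W1 U1 : cross_layer k W1 U1 set0.
Proof. by apply/forall_inP=> x _; apply/forall_inP=> y; rewrite inE. Qed.

Lemma cross_layer_set0 k U1 U2 : cross_layer k set0 U1 U2.
Proof. by apply/forall_inP=> x; rewrite inE. Qed.

Lemma lcount_gsum_cons k W1 W2 a s :
  @lcount (gsum k G1 G2) (dsum W1 W2) (a :: s) =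
  \sum_(U1 | layer W1 U1) \sum_(U2 | [&& layer W2 U2, cross_layer k W1 U1 U2 & #|U1| + #|U2| == a])
    @lcount (gsum k G1 G2) (dsum (W1 :\: U1) (W2 :\: U2)) s.
Proof.
rewrite /= big_dsum [RHS]big_mkcond /=; apply: eq_bigr => U1 _.
case: ifP => hU1; last by rewrite big_pred0 // => U2; rewrite layer_gsum hU1.
apply: eq_big => [U2|U2 _]; last by rewrite dsumD.
by rewrite layer_gsum hU1 /= card_dsum andbA.
Qed.

Lemma lcount_gsum0 k W2 s :
  @lcount (gsum k G1 G2) (dsum set0 W2) s = lcount W2 s.
Proof.
elim: s W2 => [|a s IH] W2; first by rewrite /= dsum_eq0 eqxx.
rewrite lcount_gsum_cons (eq_bigl (pred1 set0)); last first.
  move=> U1 /=; have [->|U0] := eqVneq U1 set0; first exact: layer0.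
  by rewrite /layer subset0 (negPf U0).
rewrite big_pred1_eq /=; apply: eq_big => [U2|U2 _]; last by rewrite setD0 IH.
by rewrite cards0 cross_layer_set0.
Qed.

(** No colour occurs on both sides of a dashed sum, so each letter is given entirely to one
    summand. *)
Lemma lcount_dashed W1 W2 s : all (leq 1) s ->
  @lcount (gsum Dashed G1 G2) (dsum W1 W2) s = shuffle (lcount W1) (lcount W2) s.
Proof.
elim: s W1 W2 => [|a s IH] W1 W2; first by rewrite /= dsum_eq0 -mulnb.
rewrite [all _ _]/= => /andP[a0 hs]; rewrite lcount_gsum_cons [RHS]/=.
rewrite shuffle_suml shuffle_sumr.
have cr (U1 : {set vert G1}) (U2 : {set vert G2}) : U1 \subset W1 -> cross_layer Dashed W1 U1 U2 = (U1 == set0) || (U2 == set0).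
  move=> sU; apply/idP/orP => [/forall_inP h|[]/eqP->]; last exact: cross_layer0.
  - have [_|/set0Pn[y yU]] := eqVneq U2 set0; [by right|left].
    apply/eqP/setP=> x; rewrite inE; apply/negP=> xU.
    by have /forall_inP/(_ y yU) := h x (subsetP sU x xU); rewrite /= xU.
  - by apply/forall_inP=> x _; apply/forall_inP=> y _; rewrite /= inE.
(* The term with [U1] empty gives the first letter to [G2]; the other terms give it to [G1]. *)
rewrite (bigD1 set0) ?layer0 //= addnC; congr (_ + _).
  have split0 : forall U1, layer W1 U1 && (U1 != set0) ->
      \sum_(U2 | [&& layer W2 U2, cross_layer Dashed W1 U1 U2 & #|U1| + #|U2| == a])
        @lcount (gsum Dashed G1 G2) (dsum (W1 :\: U1) (W2 :\: U2)) s =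
      if #|U1| == a then shuffle (lcount (W1 :\: U1)) (lcount W2) s else 0.
    move=> U1 /andP[/andP[sU _] U0].
    rewrite (eq_bigl (fun U2 => (U2 == set0) && (#|U1| == a))) => [|U2]; last first.
      rewrite cr // (negPf U0) /=; have [->|] := eqVneq U2 set0; last by rewrite andbF.
      by rewrite layer0 cards0 addn0.
    case: (#|U1| == a); last by rewrite big_pred0 // => U2; rewrite andbF.
    by rewrite (eq_bigl (pred1 set0)) ?big_pred1_eq ?setD0 ?IH // => U2; rewrite andbT.
  rewrite (eq_bigr _ split0) -big_mkcondr /=; apply: eq_bigl => U1.
  have [->|] := eqVneq U1 set0; rewrite ?andbT // cards0 andbF; apply/esym/negbTE; lia.
apply: eq_big => [U2|U2 _]; last by rewrite setD0 IH.
by rewrite cr ?sub0set // eqxx cards0.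
Qed.

End GraphSum.

(** * Sums of cycles *)

(** A double edge into the layer must start in it, so [U] is closed under the cyclic predecessor and
    a nonempty [U] is the whole cycle. *)
Lemma layer_cyc m (U : {set vert (cyc m)}) : 0 < m ->
  @layer (cyc m) setT U = (U == set0) || (U == setT).
Proof.
move=> m0; apply/idP/orP => [|[]/eqP->]; last 2 first.
- exact: layer0.
- rewrite /layer subsetT; apply/forall_inP=> x _; apply/forall_inP=> y _.
  by rewrite inE /=; case: ifP.
rewrite /layer subsetT /= => /forall_inP h.
have [|/set0Pn[y yU]] := eqVneq U set0; [by left|right].
have step (i j : 'I_m) : j = i.+1 %% m :> nat -> j \in U -> i \in U.
  move=> ij jU; have := forall_inP (h i (in_setT _)) j jU; rewrite /= ij eqxx andbT.
  case: ifP => // m1 _; suff -> : i = j by [].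
  by apply/val_inj=> /=; have := ltn_ord i; have := ltn_ord j; move: m1; rewrite ltnNge => /negbFE; lia.
have down (k : nat) (i j : 'I_m) : j = i + k :> nat -> j \in U -> i \in U.
  elim: k i j => [|k IH] i j ij jU; first by rewrite (_ : i = j) //; apply/ord_inj; lia.
  have lt : i.+1 < m by have := ltn_ord j; rewrite ij; lia.
  apply: (step i (Ordinal lt)); first by rewrite /= modn_small.
  by apply: IH jU; rewrite /= ij; lia.
(* Descending from any vertex of [U] reaches 0, the closing edge leads to the last vertex, and
   descending from there reaches every vertex. *)
have zU : Ordinal m0 \in U by apply: (down y _ y).
have lt : m.-1 < m by lia.
have mU : Ordinal lt \in U by apply: step zU; rewrite /= prednK // modnn.
apply/eqP/setP=> x; rewrite inE; apply: (down (m.-1 - x) _ _ _ mU) => /=.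
by have := ltn_ord x; lia.
Qed.

Lemma cyc_setT_neq0 m : 0 < m -> (setT : {set vert (cyc m)}) != set0.
Proof. by move=> m0; rewrite -card_gt0 cardsT card_ord. Qed.

Lemma lcount_cyc m s : 0 < m -> all (leq 1) s -> @lcount (cyc m) setT s = (s == [:: m]).
Proof.
move=> m0; case: s => [|a s] /=; first by rewrite (negPf (cyc_setT_neq0 m0)).
move=> /andP[a0 hs]; rewrite eqseq_cons.
rewrite (eq_bigl (fun U => (U == setT) && (a == m))) => [|U].
  case: (a == m); last by rewrite big_pred0 // => U; rewrite andbF.
  rewrite (eq_bigl (pred1 setT)) => [|U]; last by rewrite andbT.
  by rewrite big_pred1_eq setDv lcount_set0.
rewrite layer_cyc //; have [->|] := eqVneq U setT.
  by rewrite orbT cardsT card_ord eq_sym.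
by rewrite orbF => _; case: eqP => // ->; rewrite cards0 /=; lia.
Qed.

Section CycleSum.

Variables (k : ekind) (m : nat) (G : egraph).
Hypothesis m_gt0 : 0 < m.

(** A solid or double edge into the layer cannot start at an uncoloured vertex outside it, so a
    nonempty first layer contains the whole cycle; after its removal only [G] is left. *)
Lemma lcount_cyc_gsum a s : k <> Dashed -> 0 < a ->
  @lcount (gsum k (cyc m) G) setT (a :: s) =
  \sum_(U | [&& layer setT U, @cross_layer (cyc m) G k setT setT U & m + #|U| == a])
     lcount (setT :\: U) s.
Proof.
move=> kD a0; rewrite -dsumT lcount_gsum_cons.
rewrite (bigD1 (setT : {set vert (cyc m)})) /=; last by rewrite layer_cyc // eqxx orbT.
rewrite [X in _ + X]big1 ?addn0 => [|U1].
  apply: eq_big => [U|U _]; first by rewrite cardsT card_ord.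
  by rewrite setDv lcount_gsum0.
rewrite layer_cyc // => /andP[/orP[]/eqP->]; [move=> _|by rewrite eqxx].
rewrite big1 // => U2 /and3P[_ /forall_inP h /eqP U2a]; exfalso.
have /set0Pn[y yU] : U2 != set0 by rewrite -card_gt0; move: U2a; rewrite cards0; lia.
have /set0Pn[x _] := cyc_setT_neq0 m_gt0.
have /forall_inP/(_ y yU) := h x (in_setT _); rewrite inE.
by case: (k) kD.
Qed.

End CycleSum.

(** Solid edges keep a layer that contains the first cycle from reaching any later one, so the
    colour classes are exactly the cycles in order. *)
Lemma lcount_A beta s : all (leq 1) beta -> all (leq 1) s ->
  @lcount (A_ beta) setT s = (s == beta).
Proof.
elim: beta s => [|m beta IH] s /=.
  move=> _ hs; rewrite (_ : setT = set0) ?lcount_set0 //.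
  by apply/setP=> -[].
move=> /andP[m0 hb]; case: s => [|a s].
  rewrite /A_ /= -dsumT dsum_eq0 => _.
  by have /negPf -> := cyc_setT_neq0 m0.
move=> /andP[a0 hs]; rewrite [LHS](@lcount_cyc_gsum Solid) //.
rewrite (eq_bigl (fun U => (U == set0) && (a == m))) => [|U].
  rewrite eqseq_cons; case: (a == m); last by rewrite big_pred0 // => U; rewrite andbF.
  rewrite (eq_bigl (pred1 set0)) => [|U]; last by rewrite andbT.
  by rewrite big_pred1_eq setD0 IH.
have [->|/set0Pn[y yU]] := eqVneq U set0.
  by rewrite layer0 cross_layer0 cards0 addn0 eq_sym.
apply/negP => /and3P[_ /forall_inP h _].
have /set0Pn[x _] := cyc_setT_neq0 m0.
by have /forall_inP/(_ y yU) := h x (in_setT _).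
Qed.

(* The smallest colour must contain the whole first cycle, and may go on in the others. *)
Lemma lcount_B_cons m beta a s : 0 < m -> 0 < a ->
  @lcount (B_ (m :: beta)) setT (a :: s) =
  if m <= a then @lcount (B_ beta) setT (a - m :: s) else 0.
Proof.
move=> m0 a0; rewrite [LHS](@lcount_cyc_gsum Double) //.
have cr U : @cross_layer (cyc m) (B_ beta) Double setT setT U.
  by apply/forall_inP=> x _; apply/forall_inP=> y _; rewrite /= inE.
case: ifP => ma; last by rewrite big_pred0 // => U; apply/negP=> /and3P[_ _ /eqP]; lia.
by rewrite /=; apply: eq_bigl => U; rewrite cr /= -[in RHS](eqn_add2l m) subnKC.
Qed.

(** Weaker than [lcount_A], but in the form that double sums satisfy as well. *)
Lemma lcount_A_gt0 (p : pred nat) beta s : all (leq 1) beta -> all p beta -> all (leq 1) s ->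
  0 < @lcount (A_ beta) setT s ->
  all p s /\ (s = beta \/ size s < size beta).
Proof. by move=> hb pb hs; rewrite lcount_A //; case: eqP => // ->; split=> //; left. Qed.

(** The letters of [s] are sums of consecutive parts of [beta]: merging parts preserves an upward
    closed [p] and shortens the word. *)
Lemma lcount_B_gt0 (p : pred nat) beta s :
  (forall i j, i <= j -> p i -> p j) ->
  all (leq 1) beta -> all p beta -> all (leq 1) s ->
  0 < @lcount (B_ beta) setT s ->
  all p s /\ (s = beta \/ size s < size beta).
Proof.
move=> pm; elim: beta s => [|m beta IH] s.
  move=> _ _ hs; rewrite (_ : setT = set0) ?lcount_set0 //; last by apply/setP=> -[].
  by case: eqP => // ->; split=> //; left.
move=> /= /andP[m0 hb] /andP[pmm pb]; case: s => [|a s].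
  by split => //; right.
move=> /= /andP[a0 hs]; rewrite [X in 0 < X](lcount_B_cons beta s m0 a0).
case: (leqP m a) => // ma; have [->|am] := eqVneq a m.
  rewrite subnn lcount_cons0 => /(IH _ hb pb hs)[-> h]; rewrite pmm; split=> //.
  by case: h => [->|h]; [left|right].
(* The first colour goes on past the first cycle: [a - m] is the first letter left for [beta], so
   [a :: s] has at most as many letters as [beta]. *)
have am0 : 0 < a - m by move: ma am; lia.
move=> /(IH (a - m :: s) hb pb)[]; first by rewrite /= am0.
move=> /= /andP[_ ->] h; rewrite (pm m a) //; split => //; right.
by case: h => [<-|] /=; lia.
Qed.

Lemma lcount_A_self beta : all (leq 1) beta -> 0 < @lcount (A_ beta) setT beta.
Proof. by move=> hb; rewrite lcount_A // eqxx. Qed.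

Lemma lcount_B_self beta : all (leq 1) beta -> 0 < @lcount (B_ beta) setT beta.
Proof.
elim: beta => [|m beta IH].
  by move=> _; rewrite (_ : setT = set0) ?lcount_set0 //; apply/setP=> -[].
move=> /= /andP[m0 hb]; rewrite [X in 0 < X](lcount_B_cons beta beta m0 m0).
by rewrite leqnn subnn lcount_cons0 IH.
Qed.

Lemma card_cycsum k beta : #|vert (cycsum k beta)| = sumn beta.
Proof.
by elim: beta => [|m beta IH] /=; [rewrite card_void | rewrite card_sum card_ord IH].
Qed.

Lemma lcount_D_cons m mu s : 0 < m -> all (leq 1) s ->
  @lcount (D_ (m :: mu)) setT s =
  shuffle (fun t => t == [:: m]) (@lcount (D_ mu) setT) s.
Proof.
move=> m0 hs; rewrite /D_ /= -dsumT [LHS](@lcount_dashed (cyc m)) //.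
by apply: eq_shuffle => // t ht; rewrite lcount_cyc.
Qed.

Lemma lcount_D_perm_inv mu : all (leq 1) mu -> perm_inv (@lcount (D_ mu) setT).
Proof.
elim: mu => [|m mu IH] /=.
  move=> _ s t hs st; rewrite (_ : setT = set0); last by apply/setP=> -[].
  rewrite !lcount_set0 //; last by rewrite -(perm_all _ st).
  by rewrite -!size_eq0 (perm_size st).
move=> /andP[m0 hm] s t hs st; rewrite !lcount_D_cons // -?(perm_all _ st) //.
apply: perm_inv_shuffle (IH hm) _ _ hs st => s' t' _ st'; congr nat_of_bool.
apply/eqP/eqP => e; move: st'; rewrite e; last by move/perm_small_eq->.
by rewrite perm_sym => /perm_small_eq ->.
Qed.

Lemma lcount_D_gt0 mu s : all (leq 1) mu -> all (leq 1) s -> 0 < @lcount (D_ mu) setT s -> perm_eq s mu.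
Proof.
elim: mu s => [|m mu IH] s /=.
  move=> _ hs; rewrite (_ : setT = set0) ?lcount_set0 //; last by apply/setP=> -[].
  by case: eqP => // ->.
move=> /andP[m0 hm] hs; rewrite lcount_D_cons // => /(shuffle_gt0 hs)[t1 [t2 [ht1 ht2 st]]].
by case: eqP => // e1 _ /(IH _ hm ht2) e2; rewrite (perm_trans st) // e1 /= perm_cons.
Qed.

Lemma lcount_D_self mu : all (leq 1) mu -> 0 < @lcount (D_ mu) setT mu.
Proof.
elim: mu => [|m mu IH].
  by move=> _; rewrite (_ : setT = set0); [rewrite lcount_set0 | apply/setP=> -[]].
case/andP=> m0 hm; rewrite lcount_D_cons /= ?m0 //.
rewrite addn_gt0 shuffle_nill ?eqxx ?mul1n ?IH // => a t.
by rewrite eqseq_cons andbF.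
Qed.

(** * The Schur graphs *)

Section Schur.

Variable mu : seq nat.
Hypothesis mu_sorted : sorted geq mu.

(* Row lengths of a Young diagram inside that of [mu], padded with zeros. *)
Definition parts := (size mu).-tuple 'I_(sumn mu).+1.
Implicit Types (lam nu rho : parts) (s : seq nat).

Definition part lam (i : nat) : nat := nth ord0 lam i.

Lemma part_default lam i : size mu <= i -> part lam i = 0.
Proof. by move=> h; rewrite /part nth_default // size_tuple. Qed.

Lemma part_mktuple (f : nat -> nat) i : i < size mu -> f i <= sumn mu ->
  part (mktuple (fun i : 'I_(size mu) => inord (f i))) i = f i.
Proof. by move=> h fi; rewrite /part -[i]/(nat_of_ord (Ordinal h)) nth_mktuple inordK. Qed.

Lemma part_inj lam nu : (forall i, i < size mu -> part lam i = part nu i) -> lam = nu.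
Proof.
move=> h; apply: eq_from_tnth => i; apply/ord_inj.
by rewrite !(tnth_nth ord0); apply: h.
Qed.

Lemma nth_le_sumn (t : seq nat) i : nth 0 t i <= sumn t.
Proof. by elim: t i => [|a t IH] [|i] //=; rewrite ?leq_addr // (leq_trans (IH i)) ?leq_addl. Qed.

Lemma mu_nonincr i : nth 0 mu i.+1 <= nth 0 mu i.
Proof.
have [h|h] := ltnP i.+1 (size mu); last by rewrite nth_default.
exact: (sortedP 0 mu_sorted).
Qed.

(** The interlacing form of a horizontal strip [nu / lam] inside [mu]. *)
Definition strip lam nu :=
  [forall i : 'I_(size mu),
     [&& part lam i <= part nu i, part nu i <= nth 0 mu i & part nu i.+1 <= part lam i]].

Lemma stripP lam nu :
  reflect (forall i, [/\ part lam i <= part nu i, part nu i <= nth 0 mu i & part nu i.+1 <= part lam i])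
          (strip lam nu).
Proof.
apply: (iffP forallP) => [h i|h i]; last by apply/and3P.
have [ih|ih] := ltnP i (size mu); first exact/and3P/(h (Ordinal ih)).
by rewrite !part_default //; apply: leq_trans ih _.
Qed.

Definition weight lam := \sum_(i < size mu) part lam i.

(** For a partition [lam] inside [mu], a skew Kostka number: it counts the semistandard tableaux of
    shape [mu / lam] and content [s], built one strip per entry value. *)
Fixpoint kostka lam s : nat :=
  if s is a :: s' then
    \sum_(nu : parts | strip lam nu && (weight nu == weight lam + a)) kostka nu s'
  else [forall i : 'I_(size mu), part lam i == nth 0 mu i].

Definition inside lam := forall i, part lam i <= nth 0 mu i /\ part lam i.+1 <= part lam i.

Lemma strip_inside lam nu : strip lam nu -> inside nu.
Proof.
move/stripP => h i; have [_ h2 h3] := h i; have [h1 _ _] := h i; split => //; lia.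
Qed.

Local Notation cell := (vert (G_ mu)).
Definition crow (p : cell) : nat := (val p).1.
Definition ccol (p : cell) : nat := (val p).2.

Lemma cell_lt (p : cell) : ccol p < nth 0 mu (crow p).
Proof. exact: valP p. Qed.

Lemma crow_lt (p : cell) : crow p < size mu.
Proof. exact: ltn_ord. Qed.

Lemma mkcell i j : j < nth 0 mu i -> exists p : cell, crow p = i /\ ccol p = j.
Proof.
move=> ij; have hi : i < size mu by rewrite ltnNge; apply: contraTN ij => h; rewrite nth_default.
have hj : j < sumn mu by apply: leq_trans ij (nth_le_sumn _ _).
by exists (exist _ (Ordinal hi, Ordinal hj) ij).
Qed.

Lemma cell_inj (p q : cell) : crow p = crow q -> ccol p = ccol q -> p = q.
Proof.
move=> h1 h2; apply/val_inj; rewrite [LHS]surjective_pairing [RHS]surjective_pairing.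
by congr (_, _); apply/ord_inj.
Qed.

Lemma edgeG (p q : cell) : edge (G_ mu) p q =
  if (crow q == (crow p).+1) && (ccol q == ccol p) then Some Solid
  else if (crow q == crow p) && (ccol q == (ccol p).+1) then Some Double else None.
Proof. by []. Qed.

Definition diag lam : {set cell} := [set p | ccol p < part lam (crow p)].

(** The bound on [lam] supplies a cell of [mu] that would witness a longer row. *)
Lemma diag_sub lam nu i : (forall i, part lam i <= nth 0 mu i) ->
  diag lam \subset diag nu -> part lam i <= part nu i.
Proof.
move=> hl /subsetP h; rewrite leqNgt; apply/negP => lt.
have [p [pi pj]] := mkcell (leq_trans lt (hl i)).
by have := h p; rewrite !inE pi pj lt ltnn => /(_ isT).
Qed.

Lemma sub_diag lam nu : (forall i, part lam i <= part nu i) -> diag lam \subset diag nu.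
Proof. by move=> h; apply/subsetP=> p; rewrite !inE => /leq_trans; apply. Qed.

Lemma diag_inj lam nu : inside lam -> inside nu -> diag lam = diag nu -> lam = nu.
Proof.
move=> il inu e; apply: part_inj => i _; apply/eqP; rewrite eqn_leq.
by rewrite !diag_sub ?e // => j; [case: (inu j)|case: (il j)].
Qed.

Lemma card_diag lam : inside lam -> #|diag lam| = weight lam.
Proof.
move=> il; rewrite -(card_imset _ val_inj).
rewrite (_ : _ @: _ = [set ij : 'I_(size mu) * 'I_(sumn mu) | ij.2 < part lam ij.1]).
  rewrite -sum1dep_card -(pair_big_dep xpredT (fun (i : 'I__) (j : 'I__) => j < part lam i) (fun _ _ => 1)) /=.
  apply: eq_bigr => i _; rewrite -(big_ord_widen _ (fun=> 1)) ?sum1_card ?card_ord //.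
  by rewrite -ltnS ltn_ord.
apply/setP=> -[i j]; rewrite inE /=; apply/imsetP/idP => [[p] |h].
  rewrite inE => h e; have {}e : (i, j) = val p := e; by move: h; rewrite /ccol /crow -e.
have [p [pi pj]] := mkcell (leq_trans h (proj1 (il i))).
exists p; first by rewrite inE pi pj.
by rewrite [RHS]surjective_pairing; congr (_, _); apply/ord_inj.
Qed.

Lemma diag_full lam : inside lam ->
  (~: diag lam == set0) = [forall i : 'I_(size mu), part lam i == nth 0 mu i].
Proof.
move=> il; rewrite -subset0 subCset setC0; apply/idP/forallP => [/subsetP h i|h].
  rewrite eqn_leq (proj1 (il i)) leqNgt; apply/negP => /mkcell[p [pi pj]].
  by have := h p (in_setT _); rewrite inE pi pj ltnn.
by apply/subsetP=> p _; rewrite inE (eqP (h (Ordinal (crow_lt p)))) cell_lt.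
Qed.

Lemma strip_layer lam nu : strip lam nu ->
  @layer (G_ mu) (~: diag lam) (diag nu :\: diag lam).
Proof.
move=> /stripP h; apply/andP; split.
  by apply/subsetP=> p; rewrite !inE => /andP[].
apply/forall_inP=> p; rewrite !inE => hp; apply/forall_inP=> q.
rewrite !inE edgeG => /andP[hq1 hq2].
have [h1 h2 h3] := h (crow p); case: ifP => [/andP[/eqP e1 /eqP e2]|_] /=.
  by move: hq2 hp; rewrite e1 e2; lia.
case: ifP => // /andP[/eqP e1 /eqP e2] /=.
by rewrite hp /=; move: hq2; rewrite e1 e2; lia.
Qed.

(** Double edges make the diagram together with the layer left-justified, hence again a diagram;
    solid edges force the interlacing. *)
Lemma layer_strip lam (U : {set cell}) : inside lam ->
  @layer (G_ mu) (~: diag lam) U -> exists2 nu, strip lam nu & U = diag nu :\: diag lam.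
Proof.
move=> il /andP[/subsetP sU /forall_inP hU]; pose X := diag lam :|: U.
have edgeU (p q : cell) : p \notin diag lam -> q \in U ->
    if edge (G_ mu) p q is Some k then layer_edge k (p \in U) else true.
  by move=> hp; apply: (forall_inP (hU p _)); rewrite inE.
(* A left neighbour is joined by a double edge, so it is already in the diagram or lies in the same
   layer. *)
have left1 (p q : cell) : crow p = crow q -> ccol q = (ccol p).+1 -> q \in X -> p \in X.
  move=> e1 e2; rewrite !in_setU; case: (boolP (p \in diag lam)) => //= hp.
  case/orP; first by move: hp; rewrite !inE -e1 e2; lia.
  move=> /(edgeU _ _ hp); rewrite edgeG e1 e2 eqxx eqxx andbT /=.
  by rewrite [crow q == _]ltn_eqF //=.
have left (p q : cell) : crow p = crow q -> ccol p <= ccol q -> q \in X -> p \in X.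
  move=> e1; move: {2}(ccol q - ccol p) (erefl (ccol q - ccol p)) => d.
  elim: d q e1 => [|d IH] q e1 hd le; first by rewrite (@cell_inj p q) //; lia.
  have [|q' [e2 e3]] := @mkcell (crow q) (ccol q).-1; first by have := cell_lt q; lia.
  move=> /(left1 q' q e2) h; apply: (IH q'); [lia|lia|lia|apply: h; lia].
(* Columns are numbered from 0, hence the successor in the row length; an empty row gets 0. *)
pose len i := \max_(p in X | crow p == i) (ccol p).+1.
have len_le i : len i <= nth 0 mu i.
  by apply/bigmax_leqP => p /andP[_ /eqP <-]; apply: cell_lt.
have lenX (p : cell) : (p \in X) = (ccol p < len (crow p)).
  apply/idP/idP => [pX|]; first by apply: (@leq_bigmax_cond _ _ (fun p => (ccol p).+1)); rewrite pX /=.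
  move=> lt; have : ~~ [forall q, (q \in X) && (crow q == crow p) ==> ((ccol q).+1 <= ccol p)].
    apply: contraL lt => /forallP h; rewrite -leqNgt; apply/bigmax_leqP => q hq.
    exact: (implyP (h q)).
  rewrite negb_forall => /existsP[q]; rewrite negb_imply -leqNgt => /andP[/andP[qX /eqP e] le].
  by apply: left qX.
pose nu : parts := mktuple (fun i : 'I_(size mu) => inord (len i)).
have partnu i : part nu i = len i.
  have [ih|ih] := ltnP i (size mu).
    by rewrite part_mktuple // (leq_trans (len_le i)) // nth_le_sumn.
  rewrite part_default //; apply/esym/eqP; rewrite -leqn0 -(nth_default 0 ih); exact: len_le.
have dnu : diag nu = X by apply/setP=> p; rewrite [LHS]inE partnu lenX.
exists nu; last first.
  rewrite dnu; apply/setP=> p; rewrite !in_set; case: (boolP (p \in U)) => [/sU|_].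
    by rewrite !inE orbT andbT => ->.
  by rewrite orbF andNb.
apply/stripP=> i; split.
- by apply: diag_sub => [j|]; [case: (il j)|rewrite dnu subsetUl].
- by rewrite partnu.
(* If interlacing fails, the cell in column [part lam i] of row [i.+1] is in the layer while the
   cell above it is uncoloured, against the solid edge between them. *)
- rewrite leqNgt; apply/negP => lt; rewrite partnu in lt.
  have ltm := leq_trans lt (len_le _).
  have [q [q1 q2]] := mkcell ltm.
  have [p [p1 p2]] := mkcell (leq_trans ltm (mu_nonincr i)).
  have : q \in X by rewrite lenX q1 q2.
  rewrite in_setU => /orP[]; first by rewrite inE q1 q2 ltnNge; case: (il i) => _ ->.
  have hp : p \notin diag lam by rewrite inE p1 p2 ltnn.
  by move=> /(edgeU _ _ hp); rewrite edgeG q1 q2 p1 p2 !eqxx.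
Qed.

(** Removing a layer from the complement of a diagram leaves the complement of a larger diagram, so
    the layer recursion is the strip recursion. *)
Lemma lcount_diag lam s : inside lam -> @lcount (G_ mu) (~: diag lam) s = kostka lam s.
Proof.
elim: s lam => [|a s IH] lam il; first by rewrite /= diag_full.
have sub nu : strip lam nu -> diag lam \subset diag nu.
  by move/stripP=> h; apply: sub_diag => i; case: (h i).
pose A := [set nu | strip lam nu && (weight nu == weight lam + a)].
have cardh nu : strip lam nu -> (#|diag nu :\: diag lam| == a) = (weight nu == weight lam + a).
  move=> hs; have sn := sub nu hs; rewrite cardsD (setIidPr sn).
  have := subset_leq_card sn; rewrite !card_diag //; last exact: strip_inside hs.
  move=> le; apply/eqP/eqP; lia.
rewrite /= (eq_bigl (mem [set diag nu :\: diag lam | nu in A])) => [|U]; last first.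
  apply/idP/imsetP => [/andP[/(layer_strip il)[nu hs e] c]|[nu]].
    by exists nu => //; rewrite inE hs /= -cardh // -e.
  by rewrite inE => /andP[hs w] ->; rewrite strip_layer // cardh.
rewrite big_imset /=; last first.
  move=> nu nu'; rewrite !inE => /andP[hs _] /andP[hs' _] e.
  apply: diag_inj; [exact: strip_inside hs|exact: strip_inside hs'|].
  by rewrite -(setID (diag nu) (diag lam)) -(setID (diag nu') (diag lam)) e !(setIidPr _) ?sub.
apply: eq_big => [nu|nu]; rewrite inE // => /andP[hs _].
rewrite -IH; last exact: strip_inside hs.
congr lcount; apply/setP=> p.
by have := subsetP (sub nu hs) p; rewrite !inE; do 2 case: (_ < _) => //=; move=> /(_ isT).
Qed.

(** The maximum at [i] and the minimum at [i.+1] involve the same pair [f i], [g i.+1] and add up to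
    its sum. *)
Lemma sum_interlace (f g : nat -> nat) n : g n = 0 ->
  \sum_(i < n) (maxn (f i) (g i.+1) + (if val i is j.+1 then minn (g i) (f j) else g 0)) =
  \sum_(i < n) f i + \sum_(i < n) g i.
Proof.
case: n => [|n] gn; first by rewrite !big_ord0.
(* In a partial sum the last maximum has not met its minimum yet; at the end [g n = 0] turns it into
   a value of [f]. *)
suff -> : forall k, \sum_(i < k.+1) (maxn (f i) (g i.+1) + (if val i is j.+1 then minn (g i) (f j) else g 0)) =
    \sum_(i < k) f i + \sum_(i < k.+1) g i + maxn (f k) (g k.+1).
  by rewrite gn maxn0 [\sum_(i < n.+1) f i]big_ord_recr /= addnAC.
elim=> [|k IH]; first by rewrite !big_ord_recr !big_ord0 /=; lia.
rewrite big_ord_recr {}IH /= [\sum_(i < k.+1) f i]big_ord_recr [\sum_(i < k.+2) g i]big_ord_recr /=.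
by lia.
Qed.

(* The Bender-Knuth involution on Gelfand-Tsetlin patterns: between two fixed shapes
   the rows of the intermediate shape range independently over intervals, and
   reflecting each row in its interval exchanges the sizes of the two strips. *)
Section Toggle.

Variables lam rho : parts.

Definition lower i := maxn (part lam i) (part rho i.+1).
Definition upper i := if i is j.+1 then minn (part rho i) (part lam j) else part rho 0.

Definition toggle (nu : parts) : parts :=
  mktuple (fun i : 'I_(size mu) => inord (lower i + upper i - part nu i)).

Definition between nu := strip lam nu && strip nu rho.

Lemma between_bounds nu i : between nu -> lower i <= part nu i <= upper i.
Proof.
move=> /andP[/stripP h1 /stripP h2]; rewrite /lower /upper.
have [a1 a2 a3] := h1 i; have [b1 b2 b3] := h2 i; rewrite geq_max a1 b3 /=.
by case: i {a1 a2 a3 b2 b3} b1 => [|j] b1 //; have [_ _ c] := h1 j; rewrite leq_min b1 c.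
Qed.

Lemma part_toggle nu i : between nu -> part (toggle nu) i = lower i + upper i - part nu i.
Proof.
move=> h; have := between_bounds i h; have [ih|ih] := ltnP i (size mu).
  move=> b; rewrite (@part_mktuple (fun i => lower i + upper i - part nu i)) //; have : upper i <= sumn mu; last by lia.
  have : upper i <= part rho i by case: (i) => // j; rewrite geq_minl.
  by move/leq_trans; apply; rewrite -ltnS ltn_ord.
rewrite !part_default // => b; suff -> : upper i = 0 by lia.
by case: i ih {b} => [|j] ih; rewrite /upper !(@part_default rho) ?min0n.
Qed.

Lemma toggle_between nu : between nu -> between (toggle nu).
Proof.
move=> h; have hb i := between_bounds i h; have hr i := part_toggle i h.
have [/stripP h1 /stripP h2] := andP h.
apply/andP; split; apply/stripP=> i; rewrite !hr;
  have := hb i; have := hb i.+1; have [_ m1 _] := h2 i; move: m1; rewrite /lower /=;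
  have : upper i <= part rho i by case: (i) => // j; rewrite geq_minl.
- by move=> u m b1 b2; split; lia.
- by move=> u m b1 b2; split; lia.
Qed.

(** A row and its reflection add up to [lower i + upper i], and [sum_interlace] gives the total of
    these. *)
Lemma weight_toggle nu : between nu -> weight (toggle nu) + weight nu = weight lam + weight rho.
Proof.
move=> h; rewrite -big_split -(@sum_interlace (part lam) (part rho)); last exact: part_default.
apply: eq_bigr => i _ /=; rewrite part_toggle // subnK //=.
by have /andP[_ le] := between_bounds i h; apply: leq_trans le (leq_addl _ _).
Qed.

(** The toggle is injective, because each row is reflected in a fixed interval, and it sends one
    weight to the other; the two inequalities are symmetric. *)
Lemma card_between w1 w2 : w1 + w2 = weight lam + weight rho ->
  #|[set nu | between nu && (weight nu == w1)]| = #|[set nu | between nu && (weight nu == w2)]|.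
Proof.
suff le v1 v2 : v1 + v2 = weight lam + weight rho ->
    #|[set nu | between nu && (weight nu == v1)]| <= #|[set nu | between nu && (weight nu == v2)]|.
  by move=> e; apply/eqP; rewrite eqn_leq !le // addnC.
move=> e; rewrite -(card_in_imset (f := toggle)) => [|nu nu']; last first.
  rewrite !inE => /andP[h _] /andP[h' _] t; apply: part_inj => i _.
  have := part_toggle i h; rewrite t part_toggle //.
  have := between_bounds i h; have := between_bounds i h'; lia.
apply/subset_leq_card/subsetP=> _ /imsetP[nu + ->]; rewrite !inE => /andP[h /eqP w].
rewrite toggle_between //=; have := weight_toggle h; lia.
Qed.

End Toggle.

Lemma kostka_cons2 lam a b s : kostka lam [:: a, b & s] =
  \sum_(rho : parts | weight rho == weight lam + a + b)
     #|[set nu | between lam rho nu && (weight nu == weight lam + a)]| * kostka rho s.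
Proof.
rewrite /= (exchange_big_dep xpredT) //= [RHS]big_mkcond; apply: eq_bigr => rho _.
rewrite sum_nat_cond_const; case: ifP => w.
  congr (_ * _); apply: eq_card => nu; rewrite !inE /between (eqP w).
  by case: (strip lam nu); case: (strip nu rho); rewrite ?andbF //=; lia.
rewrite eq_card0 // => nu; rewrite !inE; move: w.
by case: (strip lam nu); case: (strip nu rho); rewrite ?andbF //=; lia.
Qed.

(** Two consecutive strips lie between shapes whose weights differ by [a + b]; [card_between] trades
    the intermediate weight [weight lam + a] for [weight lam + b]. *)
Lemma kostka_swap lam p a b s : kostka lam (p ++ a :: b :: s) = kostka lam (p ++ b :: a :: s).
Proof.
elim: p lam => [|c p IH] lam; last by apply: eq_bigr => nu _; apply: IH.
rewrite !cat0s !kostka_cons2; apply: eq_big => [rho|rho /eqP w]; first by rewrite addnAC.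
by congr (_ * _); apply: card_between; lia.
Qed.

Lemma kostka_cons_gt0 lam a s : 0 < kostka lam (a :: s) ->
  exists nu, [/\ strip lam nu, weight nu = weight lam + a & 0 < kostka nu s].
Proof.
rewrite /= lt0n sum_nat_eq0 negb_forall => /existsP[nu].
by rewrite negb_imply -lt0n => /andP[/andP[h /eqP w] k]; exists nu.
Qed.

(** A horizontal strip has at most one cell per column, hence at most as many cells as the first row
    of [mu]. *)
Lemma kostka_part_le lam s : 0 < kostka lam s -> all (geq (nth 0 mu 0)) s.
Proof.
elim: s lam => // a s IH lam /kostka_cons_gt0[nu [/stripP h w /IH hs]].
rewrite /= hs andbT; apply: leq_trans (_ : part nu 0 <= _); last by case: (h 0).
suff : weight nu <= part nu 0 + weight lam by lia.
rewrite /weight; case: (size mu) => [|n]; first by rewrite !big_ord0.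
rewrite big_ord_recl leq_add2l /= [leqRHS]big_ord_recr /= (leq_trans _ (leq_addr _ _)) //.
by apply: leq_sum => i _; case: (h i).
Qed.

(* The sum of the entries (numbered from [k]) of a tableau of content [s]. *)
Fixpoint depth k s := if s is a :: s' then k * a + depth k.+1 s' else 0.

(** For [k = 0] and [s = mu] the right side is the sum of the row indices of the cells of [mu],
    which is compared below with the sum of the entries of a tableau. *)
Lemma depthE k s : depth k s = \sum_(i < size s) (k + i) * nth 0 s i.
Proof.
elim: s k => [|a s IH] k /=; first by rewrite big_ord0.
by rewrite big_ord_recl addn0 IH; congr (_ + _); apply: eq_bigr => i _; rewrite addnS.
Qed.

Lemma eq_sum_leq n (f g : 'I_n -> nat) : (forall i, f i <= g i) ->
  \sum_(i < n) f i = \sum_(i < n) g i -> forall i, f i = g i.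
Proof.
move=> h /eqP e i; have := leqif_sum (fun i (_ : true) => leqif_eq (h i)).
by case=> _; rewrite e => /esym/forall_inP/(_ i isT)/eqP.
Qed.

(** Cells filled with [k] lie in rows of index at most [k], so the row indices sum to at most the
    sum of the entries. Equality forces every new entry to be its row index, which determines the
    content. Here [d] accounts for the cells already in [lam]. *)
Lemma depth_kostka lam k s : all (leq 1) mu -> all (leq 1) s ->
  (forall i, k <= i -> part lam i = 0) -> 0 < kostka lam s ->
  let d := \sum_(i < size mu) i * part lam i in
  depth 0 mu <= d + depth k s /\
  (depth 0 mu = d + depth k s ->
   (forall i, i < k -> part lam i = nth 0 mu i) /\ s = drop k mu).
Proof.
move=> mu1; elim: s lam k => [|a s IH] lam k.
  move=> _ lk /=; rewrite addn0 lt0b => /forallP h.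
  have hi i : part lam i = nth 0 mu i.
    have [ih|ih] := ltnP i (size mu); first exact/eqP/(h (Ordinal ih)).
    by rewrite part_default // nth_default.
  rewrite depthE; split; first by apply: leq_sum => i _; rewrite hi.
  move=> _; split=> //; apply/esym/eqP; rewrite -size_eq0 size_drop subn_eq0 leqNgt.
  by apply/negP => /(all_nthP 0 mu1); rewrite -hi lk.
move=> /= /andP[a0 hs] lk /kostka_cons_gt0[nu [/stripP h w kn]].
have nk i : k < i -> part nu i = 0.
  by case: i => // i ki; have [_ _] := h i; rewrite (lk i) //; lia.
have [le eq] := IH nu k.+1 hs nk kn.
(* This says [i * x <= k * x] for the number [x] of new cells in row [i], written without
   subtraction. *)
have term (i : 'I_(size mu)) : i * part nu i + k * part lam i <= i * part lam i + k * part nu i.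
  have [ki|ki] := ltnP k i; first by rewrite nk // lk // ltnW.
  have [l1 _ _] := h i; move: l1 ki; move: (part nu i) (part lam i) (nat_of_ord i) => x y z.
  by move=> /subnKC <- /subnKC <-; nia.
have total : \sum_(i < size mu) i * part nu i <= \sum_(i < size mu) i * part lam i + k * a.
  have : \sum_(i < size mu) (i * part nu i + k * part lam i) <= \sum_(i < size mu) (i * part lam i + k * part nu i).
    by apply: leq_sum => i _; apply: term.
  rewrite !big_split /= -!big_distrr /= -/(weight nu) -/(weight lam) w; nia.
rewrite addnA; split; first by apply: leq_trans le _; rewrite leq_add2r.
move=> e; have e1 : depth 0 mu = \sum_(i < size mu) i * part nu i + depth k.+1 s.
  by apply/eqP; rewrite eqn_leq le /= e leq_add2r.
have [r1 r2] := eq e1.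
have tot_eq : \sum_(i < size mu) i * part nu i = \sum_(i < size mu) i * part lam i + k * a.
  by apply/eqP; rewrite -(eqn_add2r (depth k.+1 s)) -e1 e.
have sum_eq : \sum_(i < size mu) (i * part nu i + k * part lam i) =
    \sum_(i < size mu) (i * part lam i + k * part nu i).
  by rewrite !big_split /= -!big_distrr /= -/(weight nu) -/(weight lam) w tot_eq mulnDr; lia.
(* Equality holds in every row, and [i < k] then leaves no room for a new cell in row [i]. *)
have rl i : i < k -> part nu i = part lam i.
  move=> ik; have [ih|ih] := ltnP i (size mu); last by rewrite !part_default.
  have /= := eq_sum_leq term sum_eq (Ordinal ih).
  have [/subnKC <- _ _] := h i; move: (part nu i - part lam i) => d.
  by rewrite -(subnKC ik); nia.
split; first by move=> i ik; rewrite -rl // r1 // ltnW.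
(* Without a row [k] the strip would be empty, against [0 < a]. *)
have [km|km] := ltnP k (size mu); last first.
  exfalso; suff : weight nu = weight lam by lia.
  by apply: eq_bigr => i _; apply: rl; apply: leq_trans km.
rewrite (drop_nth 0 km) -r2 -r1 //; congr (_ :: _).
(* All rows but [k] agree in [lam] and [nu], so the whole strip of size [a] is row [k]. *)
move: w; rewrite /weight (bigD1 (Ordinal km)) //= [X in _ = X + _](bigD1 (Ordinal km)) //= (lk k) //.
rewrite add0n addnC => /esym; rewrite (eq_bigr (fun i : 'I_(size mu) => part nu i)) => [/addnI //|i ik].
apply: esym; have [ki|ki] := ltnP i k; first exact: rl.
have {}ki : k < i by rewrite ltn_neqAle ki andbT eq_sym.
by rewrite nk // lk // ltnW.
Qed.

Definition trunc k : parts :=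
  mktuple (fun i : 'I_(size mu) => inord (if i < k then nth 0 mu i else 0)).

Lemma part_trunc k i : part (trunc k) i = if i < k then nth 0 mu i else 0.
Proof.
have [ih|ih] := ltnP i (size mu); last by rewrite part_default // nth_default //; case: ifP.
by rewrite (@part_mktuple (fun i => if i < k then nth 0 mu i else 0)) //; case: ifP => // _; apply: nth_le_sumn.
Qed.

Lemma inside_trunc k : inside (trunc k).
Proof.
move=> i; rewrite !part_trunc; split; first by case: ifP.
by have := mu_nonincr i; case: (ltnP i.+1 k); case: (ltnP i k); lia.
Qed.

(** The witness is the tableau whose entries equal their row index: each strip is one full row. *)
Lemma kostka_self k : 0 < kostka (trunc k) (drop k mu).
Proof.
move: {2}(size mu - k) (erefl (size mu - k)) => d; elim: d k => [|d IH] k hk.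
  have km : size mu <= k by lia.
  rewrite drop_oversize //= lt0b; apply/forallP=> i; rewrite part_trunc.
  by rewrite (leq_trans (ltn_ord i) km).
have km : k < size mu by lia.
rewrite (drop_nth 0 km) /= (bigD1 (trunc k.+1)) /=.
  by rewrite addn_gt0 IH //; lia.
apply/andP; split.
  apply/stripP=> i; rewrite !part_trunc; have := mu_nonincr i.
  by rewrite !ltnS; split; case: (ltnP i k); case: (leqP i k); lia.
rewrite /weight (bigD1 (Ordinal km)) //= [X in _ == X + _](bigD1 (Ordinal km)) //=.
rewrite !part_trunc ltnn ltnSn add0n addnC eqn_add2r; apply/eqP/eq_bigr => i ik.
by rewrite !part_trunc ltnS [i <= k]leq_eqVlt (negPf (ik : (nat_of_ord i != k))).
Qed.

Lemma lcount_G s : @lcount (G_ mu) setT s = kostka (trunc 0) s.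
Proof.
rewrite -(lcount_diag _ (inside_trunc 0)); congr lcount.
by apply/setP=> p; rewrite !inE part_trunc.
Qed.

Lemma lcount_G_perm_inv : perm_inv (@lcount (G_ mu) setT).
Proof. by apply: perm_inv_swap => p a b s _; rewrite !lcount_G kostka_swap. Qed.

Lemma card_G : #|vert (G_ mu)| = sumn mu.
Proof.
have full : diag (trunc (size mu)) = setT.
  by apply/setP=> p; rewrite !inE part_trunc crow_lt cell_lt.
rewrite -cardsT -full card_diag; last exact: inside_trunc.
rewrite sumnE (big_nth 0) big_mkord; apply: eq_bigr => i _.
by rewrite part_trunc ltn_ord.
Qed.

Lemma lcount_G_gt0 s : all (leq 1) mu -> all (leq 1) s -> 0 < @lcount (G_ mu) setT s ->
  all (geq (nth 0 mu 0)) s /\ (s = mu \/ depth 0 mu < depth 0 s).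
Proof.
rewrite lcount_G => mu1 s1 k0; split; first exact: kostka_part_le k0.
have [|le eq] := depth_kostka (k := 0) mu1 s1 _ k0; first by move=> i _; rewrite part_trunc.
have z : \sum_(i < size mu) i * part (trunc 0) i = 0 by apply: big1 => i _; rewrite part_trunc muln0.
rewrite z add0n in le eq; move: le; rewrite leq_eqVlt => /orP[/eqP/eq[_ ->]|]; last by right.
by rewrite drop0; left.
Qed.

Lemma lcount_G_self : 0 < @lcount (G_ mu) setT mu.
Proof. by rewrite lcount_G; have := kostka_self 0; rewrite drop0. Qed.

End Schur.

(** * Triangular bases *)

Section Span.

Variables (T : eqType) (A : Type) (E : seq T).
Implicit Types (f g : T -> A -> rat) (F G : A -> rat).

Definition span f F := exists c, forall x, F x = (\sum_(a <- E) c a * f a x)%R.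

Lemma span_eq f F G : (forall x, F x = G x) -> span f F -> span f G.
Proof. by move=> e [c h]; exists c => x; rewrite -e h. Qed.

Lemma span0 f : span f (fun=> 0%R).
Proof. by exists (fun=> 0%R) => x; rewrite big1 // => a _; rewrite mul0r. Qed.

Lemma span_lin f F G k : span f F -> span f G -> span f (fun x => k * F x + G x)%R.
Proof.
move=> [c hc] [d hd]; exists (fun a => k * c a + d a)%R => x.
rewrite hc hd mulr_sumr -big_split; apply: eq_bigr => a _ /=.
by rewrite mulrDl mulrA.
Qed.

(** Membership is asked only where the coefficient is nonzero, since triangularity gives information
    only there. *)
Lemma span_sum f (I : eqType) (l : seq I) (c : I -> rat) (F : I -> A -> rat) :
  (forall i, i \in l -> c i != 0%R -> span f (F i)) ->
  span f (fun x => \sum_(i <- l) c i * F i x)%R.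
Proof.
elim: l => [|i l IH] h; first by apply: span_eq (span0 f) => x; rewrite big_nil.
have hl : span f (fun x => \sum_(i <- l) c i * F i x)%R.
  by apply: IH => j jl; apply: h; rewrite inE jl orbT.
have [ci|ci] := eqVneq (c i) 0%R.
  by apply: span_eq hl => x; rewrite big_cons ci mul0r add0r.
apply: span_eq (span_lin (c i) (h i (mem_head _ _) ci) hl) => x.
by rewrite big_cons.
Qed.

Hypothesis E_uniq : uniq E.

Lemma mem_span f a : a \in E -> span f (f a).
Proof.
move=> aE; exists (fun b => (b == a)%:R)%R => x.
rewrite (bigD1_seq a) //= eqxx mul1r big1 ?addr0 // => b /negPf ->.
by rewrite mul0r.
Qed.

Variables (pt : T -> A) (delta : T -> A -> rat) (f : T -> A -> rat) (rank : T -> nat).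
Hypothesis f_delta : forall a, a \in E -> forall x, f a x = (\sum_(b <- E) f a (pt b) * delta b x)%R.
Hypothesis f_diag : forall a, a \in E -> f a (pt a) != 0%R.
Hypothesis f_triangular : forall a b, a \in E -> b \in E -> f a (pt b) != 0%R ->
  b = a \/ rank b < rank a.

(** [f b] is a nonzero multiple of [delta b] plus terms [delta a] of smaller rank; induction on the
    rank inverts this relation. *)
Lemma delta_span b : b \in E -> span f (delta b).
Proof.
move: {2}(rank b).+1 (ltnSn (rank b)) => k; elim: k b => // k IH b rk bE.
pose c a := if a == b then 0%R else (- (f b (pt a) / f b (pt b)))%R.
have hs : span f (fun x => \sum_(a <- E) c a * delta a x)%R.
  apply: span_sum => a aE; rewrite /c; have [ab|ab] := eqVneq a b; first by rewrite eqxx.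
  rewrite oppr_eq0 mulf_eq0 negb_or => /andP[h _]; apply: IH => //.
  by case: (f_triangular bE aE h) => [e|lt]; [rewrite e eqxx in ab|apply: leq_trans lt _].
apply: span_eq (span_lin (f b (pt b))^-1 (mem_span f bE) hs) => x.
have -> : (\sum_(a <- E) c a * delta a x =
    - ((f b (pt b))^-1 * \sum_(a <- E | a != b) f b (pt a) * delta a x))%R.
  rewrite (bigD1_seq b) //= /c eqxx mul0r add0r mulr_sumr -sumrN.
  by apply: eq_bigr => a /negPf ->; rewrite mulrA mulNr [(_^-1 * _)%R]mulrC.
by rewrite [f b x]f_delta // (bigD1_seq b) //= mulrDr addrK mulKf ?f_diag.
Qed.

(** At the point [pt a] only [f a] and members of larger rank can be nonzero, so the coefficients
    vanish by induction downwards from the maximal rank [K]. *)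
Lemma triangular_free c : (forall x, \sum_(a <- E) c a * f a x = 0)%R ->
  forall a, a \in E -> c a = 0%R.
Proof.
move=> h0; pose K := \max_(a <- E) rank a.
suff H k a : K - rank a < k -> a \in E -> c a = 0%R by move=> a; apply: (H _ a (ltnSn _)).
elim: k a => // k IH a rk aE.
have := h0 (pt a); rewrite (bigD1_seq a) //= big_seq_cond big1 ?addr0 => [|b /andP[bE ab]].
  by move/eqP; rewrite mulf_eq0 (negPf (f_diag aE)) orbF => /eqP.
have [->|h] := eqVneq (f b (pt a)) 0%R; first by rewrite mulr0.
case: (f_triangular bE aE h) => [e|lt]; first by rewrite e eqxx in ab.
rewrite IH ?mul0r //; have : rank b <= K by apply: (leq_bigmax_seq (F := rank)).
by move: rk lt; lia.
Qed.

End Span.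

(** * Reading exponent words as r-compositions, and the basis criterion *)

Section RCompositions.

Variables (r : option nat) (n : nat).

Fixpoint bounded_seqs (m k : nat) : seq (seq nat) :=
  if k is k'.+1 then [::] :: [seq x :: s | x <- iota 0 m.+1, s <- bounded_seqs m k'] else [:: [::]].

Lemma mem_bounded_seqs m k s : size s <= k -> all (geq m) s -> s \in bounded_seqs m k.
Proof.
elim: k s => [|k IH] [|x s] // sk /andP[xm hs].
rewrite [bounded_seqs _ _]/bounded_seqs -/bounded_seqs inE; apply/orP; right.
by apply/allpairsP; exists (x, s); split=> //; [rewrite mem_iota add0n ltnS|apply: IH].
Qed.

(** Positive parts with sum [n] are at most [n] in number and in size, so the bounded search misses
    nothing. *)
Definition rcomps : seq (seq nat * seq nat) :=
  undup [seq a <- [seq (b, m) | b <- bounded_seqs n n, m <- bounded_seqs n n] | rcomp r n a].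

Lemma rcomps_uniq : uniq rcomps.
Proof. exact: undup_uniq. Qed.

Lemma size_le_sumn s : all (leq 1) s -> size s <= sumn s.
Proof. by elim: s => //= a s IH /andP[a0 /IH]; lia. Qed.

Lemma all_le_sumn s : all (geq (sumn s)) s.
Proof.
elim: s => //= a s IH; rewrite leq_addr /=; apply: sub_all IH => x /=.
by move/leq_trans; apply; apply: leq_addl.
Qed.

Lemma rcompP b m : reflect
  [/\ all (leq 1) b /\ all (ge_r r) b, all (leq 1) m /\ all (predC (ge_r r)) m,
      sorted geq m & sumn b + sumn m = n] (rcomp r n (b, m)).
Proof.
have lt_geE x : lt_r r x = ~~ ge_r r x by case: (r) => //= k; rewrite ltnNge.
rewrite /rcomp !all_predI (eq_all (a1 := lt_r r) (a2 := predC (ge_r r))) //.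
apply: (iffP and4P) => [[/andP h1 /andP h2 h3 /eqP h4]|[/andP h1 /andP h2 h3 /eqP h4]]; first by split.
by split.
Qed.

Lemma mem_rcomps a : (a \in rcomps) = rcomp r n a.
Proof.
rewrite mem_undup mem_filter; case: a => b m; case: rcompP => //= -[[b1 _] [m1 _] _ e].
have bnd s : all (leq 1) s -> sumn s <= n -> s \in bounded_seqs n n.
  move=> s1 sn; apply: mem_bounded_seqs; first exact: leq_trans (size_le_sumn s1) sn.
  by apply: sub_all (all_le_sumn s) => x /= /leq_trans; apply.
by apply: allpairs_f; apply: bnd => //; rewrite -e ?leq_addr ?leq_addl.
Qed.

(** Sorting the small letters loses nothing for the coefficients, because the second factor is
    symmetric; the large letters keep their order. *)
Definition rtype (s : seq nat) : seq nat * seq nat :=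
  let t := filter (leq 1) s in
  (filter (ge_r r) t, sort geq (filter (predC (ge_r r)) t)).

Definition word (a : seq nat * seq nat) := a.1 ++ a.2.

Lemma sumn_filter_pos s : sumn (filter (leq 1) s) = sumn s.
Proof. by elim: s => //= -[|a] s IH //=; rewrite IH. Qed.

Lemma sumn_filterC (p : pred nat) s : sumn (filter p s) + sumn (filter (predC p) s) = sumn s.
Proof. by elim: s => //= a s <-; case: (p a) => /=; lia. Qed.

Lemma rcomp_rtype s : rcomp r n (rtype s) = (sumn s == n).
Proof.
have e : sumn (rtype s).1 + sumn (rtype s).2 = sumn s.
  have so t : sumn (sort geq t) = sumn t by apply: perm_sumn; rewrite perm_sort.
  by rewrite /rtype so sumn_filterC sumn_filter_pos.
apply/rcompP/eqP; first by rewrite e => -[].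
move=> sn; split; last by rewrite e.
- by split; [rewrite all_filter; apply/allP=> x; rewrite mem_filter => /andP[h _] /=; rewrite h implybT|apply: filter_all].
- rewrite !all_sort; split; last exact: filter_all.
  by rewrite all_filter; apply/allP=> x; rewrite mem_filter => /andP[h _] /=; rewrite h implybT.
- by apply: sort_sorted => x y; apply: leq_total.
Qed.

Lemma rtype_word a : rcomp r n a -> rtype (word a) = a.
Proof.
case: a => b m /rcompP[[b1 br] [m1 mr] ms _].
rewrite /rtype /word /= !filter_cat (all_filterP b1) (all_filterP m1).
rewrite (all_filterP br) (all_filterP mr) (_ : filter (ge_r r) m = [::]); last first.
  by apply/eqP; rewrite -size_eq0 size_filter; move: mr; rewrite all_predC has_count -leqNgt leqn0.
rewrite (_ : filter (predC (ge_r r)) b = [::]); last first.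
  apply/eqP; rewrite -size_eq0 size_filter -leqn0 leqNgt -has_count has_predC negbK //.
rewrite cats0 /= sorted_sort //; exact: rev_trans leq_trans.
Qed.

Definition left_family (X : seq nat -> egraph) := forall b, all (leq 1) b -> all (ge_r r) b ->
  0 < @lcount (X b) setT b /\
  forall s, all (leq 1) s -> 0 < @lcount (X b) setT s ->
    [/\ all (ge_r r) s, sumn s = sumn b & s = b \/ size s < size b].

(** The comparison with [m] is restricted to sorted words, since by symmetry a rearrangement of [m]
    has the same nonzero coefficient. *)
Definition right_family (Y : seq nat -> egraph) := forall m, all (leq 1) m ->
  all (predC (ge_r r)) m -> sorted geq m ->
  [/\ 0 < @lcount (Y m) setT m, perm_inv (@lcount (Y m) setT) &
  forall s, all (leq 1) s -> 0 < @lcount (Y m) setT s ->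
    [/\ all (predC (ge_r r)) s, sumn s = sumn m &
        sorted geq s -> s = m \/ depth 0 m < depth 0 s]].

Definition dashed_family X Y (a : seq nat * seq nat) : series :=
  chromX (gsum Dashed (X a.1) (Y a.2)).

Section Families.

Variables X Y : seq nat -> egraph.
Hypotheses (hX : left_family X) (hY : right_family Y).
Local Notation f := (dashed_family X Y).

Lemma dashed_familyE a s : rcomp r n a ->
  f a s = ((@lcount (X a.1) setT (rtype s).1 * @lcount (Y a.2) setT (rtype s).2)%:R)%R.
Proof.
case: a => b m /rcompP[[b1 br] [m1 mr] ms e] /=.
have [_ hb] := hX b1 br; have [_ hp hm] := hY m1 mr ms.
rewrite /dashed_family /chromX coefXG_lcount lcount_filter -dsumT lcount_dashed ?filter_all //.
rewrite (shuffle_filter (p := ge_r r)) ?filter_all //.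
- congr (_ * _)%:R%R; apply: hp; last by rewrite perm_sym perm_sort.
  by rewrite all_filter; apply/allP=> x; rewrite mem_filter => /andP[h _] /=; rewrite h implybT.
- by move=> t t1 /(hb t t1)[].
- by move=> t t1 /(hm t t1)[].
Qed.

Lemma dashed_family_word a b : rcomp r n a -> rcomp r n b ->
  f a (word b) = ((@lcount (X a.1) setT b.1 * @lcount (Y a.2) setT b.2)%:R)%R.
Proof. by move=> ha hb; rewrite dashed_familyE // rtype_word. Qed.

(** The coefficient at [s] depends on [rtype s] only, and words of degree other than [n] contribute
    nothing. *)
Lemma dashed_family_delta a : a \in rcomps -> forall s,
  f a s = (\sum_(b <- rcomps) f a (word b) * (rtype s == b)%:R)%R.
Proof.
rewrite mem_rcomps => ha s; have [sn|sn] := boolP (rtype s \in rcomps).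
  rewrite (bigD1_seq (rtype s)) ?rcomps_uniq //= eqxx mulr1 big1 ?addr0 => [|b].
    by rewrite dashed_family_word ?dashed_familyE -?mem_rcomps // mem_rcomps.
  by rewrite eq_sym => /negPf ->; rewrite mulr0.
(* Here [rtype s] is not an r-composition of [n]; a nonzero coefficient would force [sumn s = n]. *)
rewrite big_seq big1 => [|b hb]; last first.
  by case: eqP => [e|_]; [rewrite e hb in sn|rewrite mulr0].
rewrite dashed_familyE //; apply/eqP; rewrite pnatr_eq0 -leqn0 leqNgt muln_gt0.
apply/negP => /andP[h1 h2]; case/negP: sn; rewrite mem_rcomps rcomp_rtype.
case: a ha h1 h2 => b m /rcompP[[b1 br] [m1 mr] ms <-] /=.
have p1 (p : pred nat) : all (leq 1) (filter p (filter (leq 1) s)).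
  by rewrite all_filter; apply/allP=> x; rewrite mem_filter => /andP[h _] /=; rewrite h implybT.
have [_ hb] := hX b1 br; have [_ hp hm] := hY m1 mr ms.
move=> /(hb _ (p1 _))[_ <- _] /hm[|_ <- _]; first by rewrite all_sort.
rewrite -[sumn s]sumn_filter_pos -(sumn_filterC (ge_r r)) eqn_add2l; apply/eqP/esym/perm_sumn.
by rewrite perm_sort.
Qed.

Let K := \max_(a <- rcomps) depth 0 a.2.
(** A nonzero coefficient shortens the first component or increases the depth of the second;
    subtracting from the maximum [K] makes both a decrease. *)
Definition rank (a : seq nat * seq nat) := size a.1 + (K - depth 0 a.2).

Lemma dashed_family_diag a : a \in rcomps -> f a (word a) != 0%R.
Proof.
rewrite mem_rcomps => ha; rewrite dashed_family_word // pnatr_eq0 -lt0n muln_gt0.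
case: a ha => b m /rcompP[[b1 br] [m1 mr] ms _] /=.
by have [-> _] := hX b1 br; have [-> _ _] := hY m1 mr ms.
Qed.

Lemma dashed_family_triangular a b : a \in rcomps -> b \in rcomps -> f a (word b) != 0%R ->
  b = a \/ rank b < rank a.
Proof.
move=> aE bE; have bK : depth 0 b.2 <= K.
  by apply: (leq_bigmax_seq (F := fun a : seq nat * seq nat => depth 0 a.2)).
move: aE bE bK; rewrite !mem_rcomps => ha hb bK.
rewrite dashed_family_word // pnatr_eq0 -lt0n muln_gt0 /rank.
case: a ha => b' m' /rcompP[[b1' br'] [m1' mr'] ms' _].
case: b hb bK => b m /rcompP[[b1 br] [m1 mr] ms _] /= mK /andP[].
have [_ hL] := hX b1' br'; have [_ _ hR] := hY m1' mr' ms'.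
move=> /(hL _ b1)[_ _ [->|lb]] /(hR _ m1)[_ _ /(_ ms)[em|lm]]; try subst m.
- by left.
- by right; lia.
- by right; lia.
- by right; lia.
Qed.

End Families.

(** Any two such families span each other, as both are triangular over the same indicator series;
    the pair [X0], [Y0] stands for the monomial family. *)
Lemma dashed_family_basis X Y X0 Y0 :
  left_family X -> right_family Y -> left_family X0 -> right_family Y0 ->
  (forall a, dashed_family X0 Y0 a = Mf a) ->
  is_basis_QSym r n (dashed_family X Y).
Proof.
move=> hX hY hX0 hY0 fM; set f := dashed_family X Y.
pose delta (b : seq nat * seq nat) (s : seq nat) : rat := ((rtype s == b)%:R)%R.
(* The second family is expanded in the indicators of [rtype], and each indicator in the first
   family. *)
have span_of X1 Y1 X2 Y2 a : left_family X1 -> right_family Y1 -> left_family X2 -> right_family Y2 ->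
    a \in rcomps -> span rcomps (dashed_family X1 Y1) (dashed_family X2 Y2 a).
  move=> hX1 hY1 hX2 hY2 aE.
  apply: span_eq (fun s => esym (dashed_family_delta hX2 hY2 aE s)) _.
  apply: span_sum => b bE _.
  apply: (delta_span rcomps_uniq (dashed_family_delta hX1 hY1)) bE.
    exact: dashed_family_diag.
  exact: dashed_family_triangular.
have rcompsP : all (rcomp r n) rcomps by apply/allP=> a; rewrite mem_rcomps.
split.
- move=> a; rewrite -mem_rcomps => aE.
  have [c hc] := span_of X0 Y0 X Y a hX0 hY0 hX hY aE.
  exists rcomps, c; split=> // s; rewrite [LHS]hc; apply: eq_bigr => b _.
  by rewrite fM.
- move=> F [t [c [/allP ht hF]]].
  suff [d hd] : span rcomps f F by exists rcomps, d.
  apply: span_eq (fun s => esym (hF s)) _; apply: span_sum => a /ht at_ _.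
  by rewrite -fM; apply: span_of; rewrite ?mem_rcomps.
- move=> t c t_uniq /allP ht h0 a at_.
  (* The relation on [t] is extended by zero to all r-compositions, where [triangular_free]
     applies. *)
  pose c' b := if b \in t then c b else 0%R.
  suff : c' a = 0%R by rewrite /c' at_.
  apply: (triangular_free rcomps_uniq (pt := word) (f := f) (rank := rank)).
  + exact: dashed_family_diag.
  + exact: dashed_family_triangular.
  + move=> s; rewrite -[RHS](h0 s) /lincomb.
    have tE : perm_eq t (filter (mem t) rcomps).
      apply: uniq_perm; rewrite ?filter_uniq ?rcomps_uniq // => b.
      by rewrite mem_filter mem_rcomps /=; case: (boolP (b \in t)) => // /ht.
    rewrite (perm_big _ tE) big_filter [RHS]big_mkcond; apply: eq_bigr => b _ /=.
    by rewrite /c' /=; case: ifP => //; rewrite mul0r.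
  + by rewrite mem_rcomps; apply: ht.
Qed.

(** * The factors of the four families *)

Lemma ge_r_mono i j : i <= j -> ge_r r i -> ge_r r j.
Proof. by case: r => //= k ij /leq_trans; apply. Qed.

Lemma left_family_A : left_family A_.
Proof.
move=> b b1 br; split; first exact: lcount_A_self.
move=> s s1 h; have [h1 h2] := lcount_A_gt0 b1 br s1 h.
by split=> //; rewrite (lcount_sumn h) cardsT card_cycsum.
Qed.

Lemma left_family_B : left_family B_.
Proof.
move=> b b1 br; split; first exact: lcount_B_self.
move=> s s1 h; have [h1 h2] := lcount_B_gt0 ge_r_mono b1 br s1 h.
by split=> //; rewrite (lcount_sumn h) cardsT card_cycsum.
Qed.

Lemma right_family_D : right_family D_.
Proof.
move=> m m1 mr ms; split; [exact: lcount_D_self|exact: lcount_D_perm_inv|].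
move=> s s1 h; have p := lcount_D_gt0 m1 s1 h.
split; [by rewrite (perm_all _ p)|exact: perm_sumn|move=> ss; left].
(* Two sorted words that are permutations of each other coincide. *)
apply: (@sorted_eq _ geq) p => // [x y z yx xz|x y]; first exact: leq_trans xz yx.
by rewrite andbC => /anti_leq.
Qed.

Lemma right_family_G : right_family G_.
Proof.
move=> m m1 mr ms; split; [exact: lcount_G_self|exact: lcount_G_perm_inv|].
move=> s s1 h; have [h1 h2] := lcount_G_gt0 ms m1 s1 h.
split=> //; last by rewrite (lcount_sumn h) cardsT card_G.
case: m mr h1 {m1 ms h h2} => [|x m] /=.
  (* For empty [m] the bound on the letters is the default 0, so a word of positive letters is
     empty. *)
  by case: s s1 => //= a s /andP[a0 _] _; rewrite leqNgt a0.
move=> /andP[xr _]; apply: sub_all => y /= yx.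
by apply: contra xr => /(ge_r_mono yx).
Qed.

End RCompositions.

Theorem mainTheorem8 (r : option nat) (hr : forall k, r = Some k -> 0 < k) (n : nat) :
  [/\ is_basis_QSym r n Mf, is_basis_QSym r n Sf,
      is_basis_QSym r n Fbarf & is_basis_QSym r n Sbarf].
Proof.
have hA := @left_family_A r; have hB := @left_family_B r.
have hD := @right_family_D r; have hG := @right_family_G r.
split.
(* [A_] and [D_] give the reference family each time, as [Mf] is their dashed family. *)
- exact: (dashed_family_basis (X := A_) (Y := D_) n hA hD hA hD).
- exact: (dashed_family_basis (X := A_) (Y := G_) n hA hG hA hD).
- exact: (dashed_family_basis (X := B_) (Y := D_) n hB hD hA hD).
- exact: (dashed_family_basis (X := B_) (Y := G_) n hB hG hA hD).
Qed.
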